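(* Let $E$ be an arbitrary directed graph and let $S$ be a commutative semiring. Then the Steinberg algebra $A_S(\mathcal{G}_E)$ of the graph groupoid $\mathcal{G}_E$ is congruence-simple if and only if the following three conditions hold: (1) $S$ is either a field or (isomorphic to) the Boolean semifield $\mathbb{B}$; (2) the only hereditary and saturated subsets of $E^0$ are $\varnothing$ and $E^0$; (3) every cycle in $E$ has an exit.
   Context: Semirings. A hemiring is $(S,+,\cdot,0)$ with $(S,+,0)$ a commutative monoid, $(S,\cdot)$ a semigroup, multiplication distributing over addition on both sides, and $0s=0=s0$. A semiring is a hemiring with a multiplicative identity $1\neq 0$. The Boolean semifield is $\mathbb{B}=(\{0,1\},\vee,\wedge,0,1)$. A congruence on a hemiring $S$ is an equivalence relation $\rho$ such that $(a,b)\in\rho$ and $s\in S$ imply $(s+a,s+b),(sa,sb),(as,bs)\in\rho$. A nonzero hemiring is congruence-simple if its only congruences are the diagonal and the universal one. Since congruence-simpleness is defined for nonzero hemirings only, $E$ is understood to have at least one vertex. Graphs. A directed graph $E=(E^0,E^1,s,r)$ has disjoint sets $E^0$ of vertices and $E^1$ of edges and maps $s,r\colon E^1\to E^0$ (source, range); no cardinality restrictions. A vertex $v$ is a sink if $s^{-1}(v)=\varnothing$, regular if $0<|s^{-1}(v)|<\infty$, an infinite emitter if $|s^{-1}(v)|=\infty$. A path is a sequence $p=e_1\dots e_n$ of edges with $r(e_i)=s(e_{i+1})$, with $s(p)=s(e_1)$, $r(p)=r(e_n)$, $|p|=n$; vertices are paths of length $0$. $E^*$ is the set of all paths and $E^\infty$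 the set of infinite paths $e_1e_2\dots$ with $r(e_i)=s(e_{i+1})$. A cycle is a path $e_1\dots e_n$ with $n\ge 1$, $s(e_1)=r(e_n)$ and $s(e_1),\dots,s(e_n)$ distinct. An edge $f$ is an exit for $e_1\dots e_n$ if for some $i$, $s(f)=s(e_i)$ and $f\ne e_i$. A subset $H\subseteq E^0$ is hereditary if $s(e)\in H$ implies $r(e)\in H$ for all $e\in E^1$; it is saturated if every regular vertex $v$ with $r(s^{-1}(v))\subseteq H$ lies in $H$. Graph groupoid. Let $X_E=\{p\in E^*\mid r(p)\text{ is a sink or an infinite emitter}\}\cup E^\infty$ and $\mathcal{G}_E=\{(\alpha x,|\alpha|-|\beta|,\beta x)\mid \alpha,\beta\in E^*,\ x\in X_E,\ r(\alpha)=s(x)=r(\beta)\}$, with $(x,k,y)(y,l,z)=(x,k+l,z)$ and $(x,k,y)^{-1}=(y,-k,x)$; the range of $(x,k,y)$ is $(x,0,x)$, its source is $(y,0,y)$. For $\alpha,\beta\in E^*$ with $r(\alpha)=r(\beta)$ and finite $F\subseteq s^{-1}(r(\alpha))$ put $Z(\alpha,\beta)=\{(\alpha x,|\alpha|-|\beta|,\beta x)\mid x\in X_E,\ s(x)=r(\alpha)\}$ and $Z(\alpha,\beta,F)=Z(\alpha,\beta)\setminus\bigcup_{e\in F}Z(\alpha e,\beta e)$. The sets $Z(\alpha,\beta,F)$ form a base of compact open bisections for a topology making $\mathcal{G}_E$ a Hausdorff ample groupoid. (An open bisection of a topological groupoid is an open subset on which the source and range maps restrict to homeomorphisms onto open subsets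 of the unit space.) Steinberg algebra. For a Hausdorff ample groupoid $\mathcal{G}$ and a commutative semiring $S$ with the discrete topology, $A_S(\mathcal{G})$ is the $S$-subsemimodule of the continuous functions $\mathcal{G}\to S$ (pointwise operations) generated by the characteristic functions $1_U$ of compact open bisections $U$, with product $(f*g)(\gamma)=\sum_{\gamma=\alpha\beta}f(\alpha)g(\beta)$. *)

(* Defs.v *)
From HB Require Import structures.
From mathcomp Require Import all_boot all_order all_algebra.
From mathcomp Require Import all_classical all_reals topology.
From mathcomp Require Import zify.

Set Implicit Arguments.
Unset Strict Implicit.
Unset Printing Implicit Defensive.

Import Order.TTheory GRing.Theory Num.Theory.
Local Open Scope classical_set_scope.
Local Open Scope ring_scope.

Record digraph := Digraph {
  vertex : Type;
  edge : Type;
  esrc : edge -> vertex;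
  etgt : edge -> vertex
}.
Arguments esrc {d} _.
Arguments etgt {d} _.

HB.instance Definition _ (E : digraph) := gen_eqMixin (vertex E).
HB.instance Definition _ (E : digraph) := gen_choiceMixin (vertex E).
HB.instance Definition _ (E : digraph) := gen_eqMixin (edge E).
HB.instance Definition _ (E : digraph) := gen_choiceMixin (edge E).

Section Graphs.
Variable E : digraph.

Definition out_edges (v : vertex E) : set (edge E) := [set e | esrc e = v].

Definition is_sink (v : vertex E) := out_edges v = set0.

Definition is_regular (v : vertex E) :=
  out_edges v !=set0 /\ finite_set (out_edges v).

Definition is_infinite_emitter (v : vertex E) := infinite_set (out_edges v).

(* A finite path is a pair (v, [:: e1; ...; en]) satisfying is_path: v is its
   source, recorded separately so that (v, [::]) is the path v of length 0. *)
Definition prepath : Type := vertex E * seq (edge E).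

Fixpoint walk (v : vertex E) (p : seq (edge E)) : bool :=
  if p is e :: q then (esrc e == v) && walk (etgt e) q else true.

Definition is_path (p : prepath) : bool := walk p.1 p.2.

Definition psrc (p : prepath) : vertex E := p.1.

Definition prng (p : prepath) : vertex E := last p.1 (map etgt p.2).

Definition plen (p : prepath) : nat := size p.2.

Definition path_rcons (p : prepath) (e : edge E) : prepath :=
  (p.1, rcons p.2 e).

Definition is_cycle (c : prepath) :=
  [/\ is_path c, (1 <= plen c)%N, psrc c = prng c & uniq (map esrc c.2)].

Definition has_exit (c : prepath) :=
  exists f, exists e, [/\ e \in c.2, esrc f = esrc e & f <> e].

Definition hereditary (H : set (vertex E)) :=
  forall e : edge E, H (esrc e) -> H (etgt e).

Definition saturated (H : set (vertex E)) :=
  forall v, is_regular v -> etgt @` out_edges v `<=` H -> H v.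

(* Finite and infinite sequences; the elements of the boundary path space X_E
   are those satisfying is_boundary. *)
Inductive gpath :=
  | FinPath of prepath
  | InfPath of (nat -> edge E).

Definition is_boundary (x : gpath) : Prop :=
  match x with
  | FinPath p => is_path p /\ (is_sink (prng p) \/ is_infinite_emitter (prng p))
  | InfPath f => forall i, etgt (f i) = esrc (f i.+1)
  end.

Definition gpath_src (x : gpath) : vertex E :=
  match x with
  | FinPath p => psrc p
  | InfPath f => esrc (f 0%N)
  end.

(* The concatenation a x, meaningful when prng a = gpath_src x. *)
Definition pcat (a : prepath) (x : gpath) : gpath :=
  match x with
  | FinPath p => FinPath (a.1, a.2 ++ p.2)
  | InfPath f => InfPath (fun i => nth (f (i - plen a)%N) a.2 i)
  end.

Definition lag_triple (a b : prepath) (x : gpath) : gpath * int * gpath :=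
  (pcat a x, (plen a)%:Z - (plen b)%:Z, pcat b x).

Definition is_arrow (t : gpath * int * gpath) : Prop :=
  exists a b x, [/\ is_path a, is_path b, is_boundary x,
    prng a = gpath_src x /\ prng b = gpath_src x & t = lag_triple a b x].

Record graph_arrow := GraphArrow {
  arrow_val :> gpath * int * gpath;
  arrowP : is_arrow arrow_val
}.

End Graphs.

Arguments FinPath {E} _.
Arguments InfPath {E} _.

Section PathFacts.
Variable E : digraph.
Implicit Types (a b c : prepath E) (x y z : gpath E).

Lemma arrow_inj (g h : graph_arrow E) :
  arrow_val g = arrow_val h -> g = h.
Proof.
case: g h => [t p] [u q] /= tu; rewrite -{u}tu in q *.
by rewrite (Prop_irrelevance p q).
Qed.

Lemma walk_cat v (p q : seq (edge E)) :
  walk v (p ++ q) = walk v p && walk (last v (map etgt p)) q.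
Proof. by elim: p v => //= e p IHp v; rewrite IHp andbA. Qed.

Lemma gpath_src_pcat a x : is_path a -> prng a = gpath_src x ->
  gpath_src (pcat a x) = psrc a.
Proof.
case: a x => [v [|e s]] [p|f] //=.
by case/andP => /eqP.
Qed.

Lemma pcat_boundary a x : is_path a -> is_boundary x ->
  prng a = gpath_src x -> is_boundary (pcat a x).
Proof.
case: a => v s; case: x => [[w p]|f]; rewrite /is_path /prng /= => wp.
  case=> wq bd vw; rewrite /is_path /prng /= walk_cat wp vw /=.
  by split=> //; move: bd; rewrite map_cat last_cat vw.
move=> Hf vf i; rewrite /plen /=.
elim: s v wp vf i => [|e s IHs] v /=; first by move=> _ _ i; rewrite !subn0 !nth_nil; exact: Hf.
case/andP=> /eqP ev ws vf [|i] /=; last by rewrite !subSS; apply: IHs ws vf i.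
case: s ws vf {IHs} => [|e' s] /=; first by rewrite subnn => _ ->.
by case/andP => /eqP ->.
Qed.

Lemma pcat_nil x : pcat (gpath_src x, [::]) x = x.
Proof.
case: x => [[v s]|f] //=; congr InfPath; apply/funext => i.
by rewrite nth_nil /plen subn0.
Qed.

Lemma pcatA a (v : vertex E) (s : seq (edge E)) x :
  pcat (a.1, a.2 ++ s) x = pcat a (pcat (v, s) x).
Proof.
case: x => [p|f] /=; first by rewrite catA.
congr InfPath; apply/funext => i; rewrite /plen /= size_cat nth_cat.
case: ltnP => h; first by apply: set_nth_default.
by rewrite [RHS]nth_default // subnDA.
Qed.

Lemma pcat_split b c x y : is_path b -> is_path c ->
  prng b = gpath_src x -> prng c = gpath_src y -> (plen b <= plen c)%N ->
  pcat b x = pcat c y ->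
  exists s, [/\ c = (b.1, b.2 ++ s), walk (prng b) s & x = pcat (prng b, s) y].
Proof.
move=> pb pc bx cy lbc eqxy.
have eqs : b.1 = c.1.
  have := gpath_src_pcat pb bx.
  by rewrite eqxy gpath_src_pcat// /psrc => ->.
have [s cE] : exists s, c.2 = b.2 ++ s.
  exists (drop (plen b) c.2); case: b c x y pb pc bx cy lbc eqxy eqs =>
    [v s] [w t] [p|f] [q|g] //= _ _ _ _.
    rewrite /plen /= => h [_ e] _; rewrite -[LHS](cat_take_drop (size s)).
    congr (_ ++ _); have := congr1 (take (size s)) e.
    by rewrite take_size_cat// takel_cat.
  rewrite /plen /= => h [e] _; rewrite -[LHS](cat_take_drop (size s)).
  congr (_ ++ _); apply: (@eq_from_nth _ (f 0%N)) => [|i].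
    by rewrite size_takel.
  rewrite size_takel// => ilt; rewrite nth_take//.
  have ei : nth (f (i - size s)%N) s i = nth (g (i - size t)%N) t i.
    exact: (congr1 (fun h => h i) e).
  rewrite (set_nth_default (g (i - size t)%N)) ?(leq_trans ilt)// -ei.
  exact: set_nth_default.
have cE' : c = (b.1, b.2 ++ s) by rewrite eqs -cE; case: (c).
have ws : walk (prng b) s.
  by move: pc; rewrite cE' /is_path /= walk_cat => /andP[].
exists s; split => //.
move: eqxy; rewrite cE' (pcatA b (prng b) s y).
case: x bx => [[w p]|f] bx; case: (y) cy => [[u q]|g] cy //=.
  by case=> /eqP; rewrite eqseq_cat// eqxx /= => /eqP ->; rewrite bx.
case=> e; congr InfPath; apply/funext => i.
have /= := congr1 (fun h => h (plen b + i)%N) e.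
by rewrite !(nth_default _ (leq_addr _ _)) addKn.
Qed.

End PathFacts.

HB.instance Definition _ (E : digraph) := gen_eqMixin (graph_arrow E).
HB.instance Definition _ (E : digraph) := gen_choiceMixin (graph_arrow E).

Section GraphTopology.
Variable E : digraph.
Implicit Types (a b c d : prepath E) (F : set (edge E)).

(* Z(a, b) and Z(a, b, F), read in the case prng a = prng b. *)
Definition Zset a b : set (graph_arrow E) :=
  [set g | exists x, [/\ is_boundary x, gpath_src x = prng a
                       & arrow_val g = lag_triple a b x]].

Definition ZsetF a b F : set (graph_arrow E) :=
  Zset a b `\` \bigcup_(e in F) Zset (path_rcons a e) (path_rcons b e).

Definition Zbase : set (set (graph_arrow E)) :=
  [set U | exists a b F, [/\ is_path a, is_path b, prng a = prng b,
     finite_set F /\ F `<=` out_edges (prng a) & U = ZsetF a b F]].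

Lemma Zbase_cover : \bigcup_(U in Zbase) U = [set: graph_arrow E].
Proof.
apply/seteqP; split=> // g _.
have [a [b [x [pa pb bx [ax bx'] gE]]]] := arrowP g.
exists (ZsetF a b set0).
  by exists a, b, set0; split=> //; rewrite ?ax ?bx'//; split=> //; exact: finite_set0.
by split; [exists x|rewrite bigcup_set0].
Qed.

Lemma prng_cat a (s : seq (edge E)) :
  prng (a.1, a.2 ++ s) = prng (prng a, s).
Proof. by rewrite /prng /= map_cat last_cat. Qed.

Lemma gpath_src_prefix a (s : seq (edge E)) x :
  walk (prng a) s -> prng (a.1, a.2 ++ s) = gpath_src x ->
  prng a = gpath_src (pcat (prng a, s) x).
Proof. by move=> ws; rewrite prng_cat => sx; rewrite gpath_src_pcat. Qed.

Lemma Zset_prefix a b (s : seq (edge E)) :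
  prng a = prng b -> walk (prng a) s ->
  Zset (a.1, a.2 ++ s) (b.1, b.2 ++ s) `<=` Zset a b.
Proof.
move=> ab ws g [x [bx xs gE]]; exists (pcat (prng a, s) x); split.
- by apply: pcat_boundary => //; rewrite xs prng_cat.
- by apply/esym/gpath_src_prefix.
- rewrite gE /lag_triple (pcatA a (prng a)) (pcatA b (prng a)).
  congr (_, _, _); rewrite /plen /= !size_cat !PoszD; lia.
Qed.

Lemma ZsetF_join_wlog a b c d F F' g : (plen a <= plen c)%N ->
  [/\ is_path a, is_path b, prng a = prng b &
      finite_set F /\ F `<=` out_edges (prng a)] ->
  [/\ is_path c, is_path d, prng c = prng d &
      finite_set F' /\ F' `<=` out_edges (prng c)] ->
  ZsetF a b F g -> ZsetF c d F' g ->
  exists U, [/\ Zbase U, U g & U `<=` ZsetF a b F `&` ZsetF c d F'].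
Proof.
move=> lac [pa pb ab [finF Fa]] [pc pd cd [finF' Fc]] [[x [bx xa gE]] gF]
  [[y [by_ yc gE']] gF'].
move: (gE); rewrite gE' => -[eac elag ebd].
have [s [cE ws xE]] := pcat_split pa pc (esym xa) (esym yc) lac (esym eac).
have lbd : (plen b <= plen d)%N by move: elag lac; lia.
have [||t [dE wt xE']] := pcat_split pb pd _ _ lbd (esym ebd).
- by rewrite -ab.
- by rewrite -cd.
have st : s = t.
  have sst : size s = size t.
    by move: elag; rewrite cE dE /plen /= !size_cat; lia.
  move: xE'; rewrite -ab xE; case: (y) => [p [/eqP]|f [e]].
    by rewrite eqseq_cat// => /andP[/eqP].
  apply: (@eq_from_nth _ (f 0%N)) => // i ilt.
  rewrite (set_nth_default (f (i - plen (prng a, s))%N))//.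
  have /= -> := congr1 (fun h => h i) e.
  by apply: set_nth_default; rewrite -sst.
subst t.
case: s => [|e s] in cE dE ws wt xE xE' *.
  have ca : c = a by rewrite cE cats0; case: (a).
  have db : d = b by rewrite dE cats0; case: (b).
  clear cE dE; subst c d; exists (ZsetF a b (F `|` F')); split.
  - exists a, b, (F `|` F'); split=> //; split; first by rewrite finite_setU.
    by move=> f [/Fa|/Fc].
  - split; first by exists x; split.
    by rewrite bigcup_setU => -[/gF|/gF'].
  - by move=> h; rewrite /ZsetF bigcup_setU setDUr.
exists (ZsetF c d F'); split.
- by exists c, d, F'; split.
- by split; [exists y; split|].
move=> h hZ; split=> //; case: hZ => hZ _; split.
  by move: h hZ; rewrite cE dE; apply: Zset_prefix.
case=> f Ff [z [bz zf hE]].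
have rE (p : prepath E) q : (p.1, p.2 ++ (q :: s)) =
    ((path_rcons p q).1, (path_rcons p q).2 ++ s).
  by rewrite /path_rcons -cats1 -catA.
have fe : f = e.
  case: hZ => w [bw wc hE']; move: hE; rewrite hE' => -[+ _ _].
  rewrite cE; case: (w) (z) => [p|k] [q|l] //=; rewrite /path_rcons -cats1.
    by rewrite -!catA /= => -[/eqP]; rewrite eqseq_cat// eqxx /= => /eqP[].
  case=> /(congr1 (fun h => h (size a.2))) /=.
  by rewrite !nth_cat ltnn subnn /= => ->.
subst f; apply: gF; exists e => //.
have se : esrc e = prng a by case/andP: ws => /eqP.
have [wse aeE] : walk (etgt e) s /\ prng (path_rcons a e) = etgt e.
  split; first by case/andP: ws.
  by rewrite /prng /= map_rcons last_rcons.
have [z' [bz' z'c gz]] : Zset c d g by exists y; split.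
have : Zset c d `<=` Zset (path_rcons a e) (path_rcons b e).
  rewrite cE dE !rE; apply: Zset_prefix; last by rewrite aeE.
  by rewrite /prng /= !map_rcons !last_rcons.
by apply; exists y; split.
Qed.

Lemma Zbase_join U V g : Zbase U -> Zbase V -> U g -> V g ->
  exists W, [/\ Zbase W, W g & W `<=` U `&` V].
Proof.
move=> [a [b [F [pa pb ab HF ->]]]] [c [d [F' [pc pd cd HF' ->]]]] Ug Vg.
have [ac|/ltnW ca] := leqP (plen a) (plen c).
  exact: (@ZsetF_join_wlog a b c d F F' g).
by rewrite setIC; exact: (@ZsetF_join_wlog c d a b F' F g).
Qed.

HB.instance Definition _ :=
  isBaseTopological.Build (graph_arrow E) Zbase_cover Zbase_join.

End GraphTopology.

(* Objects are identified with their unit arrows. No compatibility between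
   the operations and the topology is part of this record. *)
Record groupoid := Groupoid {
  garrow :> topologicalType;
  gsrc : garrow -> garrow;
  grng : garrow -> garrow;
  ginv : garrow -> garrow;
  gmul : forall g h, gsrc g = grng h -> garrow;
  gsrc_src : forall g, gsrc (gsrc g) = gsrc g;
  grng_src : forall g, grng (gsrc g) = gsrc g;
  gsrc_rng : forall g, gsrc (grng g) = grng g;
  grng_rng : forall g, grng (grng g) = grng g;
  gsrc_mul : forall g h (e : gsrc g = grng h), gsrc (gmul e) = gsrc h;
  grng_mul : forall g h (e : gsrc g = grng h), grng (gmul e) = grng g;
  gmulA : forall g h k (e : gsrc g = grng h) (e' : gsrc h = grng k)
    (l : gsrc g = grng (gmul e')) (r : gsrc (gmul e) = grng k),
    gmul l = gmul r;
  gmul_src : forall g (e : gsrc g = grng (gsrc g)), gmul e = g;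
  gmul_rng : forall g (e : gsrc (grng g) = grng g), gmul e = g;
  gsrc_inv : forall g, gsrc (ginv g) = grng g;
  grng_inv : forall g, grng (ginv g) = gsrc g;
  gmulV : forall g (e : gsrc g = grng (ginv g)), gmul e = grng g;
  gmulVl : forall g (e : gsrc (ginv g) = grng g), gmul e = gsrc g
}.

Section GraphGroupoid.
Variable E : digraph.
Implicit Types (g h : graph_arrow E) (x y : gpath E).

Definition ga_rng g : gpath E := g.1.1.
Definition ga_lag g : int := g.1.2.
Definition ga_src g : gpath E := g.2.

Fact unit_src_subproof g : is_arrow (ga_src g, 0, ga_src g).
Proof.
have [a [b [x [pa pb bx [ax bx'] gE]]]] := arrowP g.
by exists b, b, x; split=> //; rewrite /ga_src gE /lag_triple subrr.
Qed.

Fact unit_rng_subproof g : is_arrow (ga_rng g, 0, ga_rng g).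
Proof.
have [a [b [x [pa pb bx [ax bx'] gE]]]] := arrowP g.
by exists a, a, x; split=> //; rewrite /ga_rng gE /lag_triple subrr.
Qed.

Fact inv_subproof g : is_arrow (ga_src g, - ga_lag g, ga_rng g).
Proof.
have [a [b [x [pa pb bx [ax bx'] gE]]]] := arrowP g.
exists b, a, x; split=> //.
by rewrite /ga_src /ga_rng /ga_lag gE /lag_triple opprB.
Qed.

Fact mul_subproof g h : ga_src g = ga_rng h ->
  is_arrow (ga_rng g, ga_lag g + ga_lag h, ga_src h).
Proof.
have [a [b [x [pa pb bx [ax bx'] gE]]]] := arrowP g.
have [c [d [y [pc pd by_ [cy dy] hE]]]] := arrowP h.
rewrite /ga_src /ga_rng /ga_lag gE hE /lag_triple /= => e.
have [le|/ltnW le] := leqP (plen b) (plen c).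
  have [s [cE ws xE]] := pcat_split pb pc bx' cy le e.
  have ab : prng a = prng b by rewrite ax.
  have as_ : prng (a.1, a.2 ++ s) = prng c.
    by rewrite prng_cat ab -prng_cat -cE.
  exists (a.1, a.2 ++ s), d, y; split=> //.
  - by rewrite /is_path walk_cat; apply/andP; split=> //; move: ws; rewrite -ab.
  - by rewrite as_.
  - rewrite xE -(pcatA a (prng b)) /lag_triple; congr (_, _, _).
    rewrite cE /plen /= !size_cat; lia.
have [s [bE ws yE]] := pcat_split pc pb cy bx' le (esym e).
have dc : prng d = prng c by rewrite dy.
have ds : prng (d.1, d.2 ++ s) = prng b.
  by rewrite prng_cat dc -prng_cat -bE.
exists a, (d.1, d.2 ++ s), x; split=> //.
- by rewrite /is_path walk_cat; apply/andP; split=> //; move: ws; rewrite -dc.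
- by rewrite ds.
- rewrite yE -(pcatA d (prng c)) /lag_triple; congr (_, _, _).
  rewrite bE /plen /= !size_cat; lia.
Qed.

Definition ga_unit_src g : graph_arrow E := GraphArrow (unit_src_subproof g).
Definition ga_unit_rng g : graph_arrow E := GraphArrow (unit_rng_subproof g).
Definition ga_inv g : graph_arrow E := GraphArrow (inv_subproof g).

Fact ga_composable g h : ga_unit_src g = ga_unit_rng h -> ga_src g = ga_rng h.
Proof. by move=> /(congr1 (@arrow_val E)) []. Qed.

Definition ga_mul g h (e : ga_unit_src g = ga_unit_rng h) : graph_arrow E :=
  GraphArrow (mul_subproof (ga_composable e)).

Fact arrow_eq g h : ga_rng g = ga_rng h -> ga_lag g = ga_lag h ->
  ga_src g = ga_src h -> g = h.
Proof.
move=> er el es; apply: arrow_inj; move: er el es.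
rewrite /ga_rng /ga_lag /ga_src.
by case: (arrow_val g) (arrow_val h) => [[? ?] ?] [[? ?] ?] /= -> -> ->.
Qed.

Definition graph_groupoid : groupoid.
Proof.
apply: (@Groupoid (graph_arrow E) ga_unit_src ga_unit_rng ga_inv ga_mul).
all: abstract (move=> *; apply: arrow_eq; rewrite //= /ga_lag /=;
  by rewrite ?addrA ?addr0 ?add0r ?subrr ?addNr).
Defined.

End GraphGroupoid.

Section SteinbergAlgebra.
Variables (G : groupoid) (S : comNzSemiRingType).
Implicit Types (f g : G -> S) (U : set G).

Definition unit_space : set G := range (@gsrc G).

(* phi restricts to a homeomorphism from U, with the subspace topology, onto
   an open subset of the unit space. *)
Definition unit_homeo (phi : G -> G) U :=
  exists (O : set G) (psi : G -> G), let V := O `&` unit_space in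
  [/\ open O, set_bij U V phi, {within U, continuous phi},
      {in U, cancel phi psi} & {within V, continuous psi}].

Definition open_bisection U :=
  [/\ open U, unit_homeo (@gsrc G) U & unit_homeo (@grng G) U].

Definition char_fun U : G -> S := fun x => (x \in U)%:R.

Definition subsemimodule (M : set (G -> S)) :=
  [/\ M 0, forall f g, M f -> M g -> M (f + g)
    & forall (c : S) f, M f -> M (fun x => c * f x)].

Definition continuous_functions : set (G -> S) :=
  [set f | continuous (f : G -> discrete_topology S)].

Definition steinberg : set (G -> S) :=
  smallest [set M | subsemimodule M /\ M `<=` continuous_functions]
    [set char_fun U | U in [set U | open_bisection U /\ compact U]].

(* The sum ranges over the factorisations x = p.1 p.2; it is finitely
   supported for f and g in the Steinberg algebra. *)
Definition convolution f g : G -> S := fun x =>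
  \sum_(p \in [set p : G * G |
      exists e : gsrc p.1 = grng p.2, gmul e = x]) (f p.1 * g p.2).

End SteinbergAlgebra.

Section Congruences.
(* The hemiring is the subset A of T, assumed closed under the addition of T
   and under mul; only the values of rho on A matter. *)
Variables (T : nmodType) (mul : T -> T -> T) (A : set T).

Definition congruence (rho : T -> T -> Prop) :=
  [/\ forall a, A a -> rho a a,
      forall a b, A a -> A b -> rho a b -> rho b a,
      forall a b c, A a -> A b -> A c -> rho a b -> rho b c -> rho a c
    & forall a b s, A a -> A b -> A s -> rho a b ->
      [/\ rho (s + a) (s + b), rho (mul s a) (mul s b)
        & rho (mul a s) (mul b s)]].

Definition congruence_simple :=
  (exists2 a, A a & a <> 0) /\
  forall rho, congruence rho ->
    (forall a b, A a -> A b -> rho a b -> a = b) \/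
    (forall a b, A a -> A b -> rho a b).

End Congruences.

Definition is_field (S : comNzSemiRingType) :=
  (forall x : S, exists y, x + y = 0) /\
  (forall x : S, x <> 0 -> exists y, x * y = 1).

Definition is_boolean_semifield (S : comNzSemiRingType) :=
  exists f : S -> bool, bijective f /\
    [/\ f 0 = false, f 1 = true, {morph f : x y / x + y >-> x || y}
      & {morph f : x y / x * y >-> x && y}].

(* Main.v *)
Require Import Defs.
From mathcomp Require Import all_boot all_order all_algebra.
From mathcomp Require Import all_classical all_reals topology.
From mathcomp Require Import zify.

(** The algebra consists of the locally constant functions with compact support
    on the groupoid ([steinberg_locally_constant], [locally_constant_steinberg]).
    This rests on the cylinders [Zset a b] being compact ([Zset_compact]) and
    clopen, and lets one check membership in the algebra, and closure under the
    products that are needed, without decomposing functions into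
    bisections.

    If the algebra is congruence-simple, each condition follows from one
    congruence that would otherwise be neither trivial nor universal:
    - a congruence of [S], applied pointwise; hence [S] is congruence-simple, and
      a commutative such semiring is a field or Boolean
      ([simple_field_or_boolean]);
    - agreement on the arrows between boundary paths that avoid a hereditary
      saturated set [H], which identifies the idempotent of [v] with 0 exactly
      when [v] is in [H];
    - inducing the same operator on functions of boundary paths, which
      identifies a cycle without exit with its base vertex, because the
      only boundary path from this vertex is fixed by the cycle.

    Conversely, let [rho] relate two distinct functions.  After a translation
    they differ at a unit.  If every cycle has an exit, any path can be extended
    so as to separate the two prefixes of a given cylinder ([separate]); doing
    this for the cylinders that cover both supports removes all
    arrows that are not units, and what remains is a pair of distinct multiples
    of the idempotent of one vertex ([diagonalize], [nontrivial_vertex]).  Over a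
    field or the Boolean semifield this pair forces that idempotent to be related
    to 0 ([vertex_killed]).  The vertices with this property form a hereditary
    saturated set ([killed_hereditary], [killed_saturated]), so all vertices have
    it, and then every function in the algebra is related to 0
    ([killed_all]). *)

Set Implicit Arguments.
Unset Strict Implicit.
Unset Printing Implicit Defensive.

Import Order.TTheory GRing.Theory.
Local Open Scope classical_set_scope.
Local Open Scope ring_scope.

(** * Paths and cylinder sets *)

Section PathsAndArrows.
Variable E : digraph.
Implicit Types (a b c d : prepath E) (s t : seq (edge E)) (x y z : gpath E).
Implicit Types (g h : graph_arrow E) (F : set (edge E)).

Definition pext a s : prepath E := (a.1, a.2 ++ s).

(** The pairs that index cylinders; [Zset a b] is only meaningful for them. *)
Definition bipath a b := [/\ is_path a, is_path b & prng a = prng b].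

Definition vpath (v : vertex E) : prepath E := (v, [::]).

Lemma is_path_pext a s : is_path (pext a s) = is_path a && walk (prng a) s.
Proof. exact: walk_cat. Qed.

Lemma plen_pext a s : plen (pext a s) = (plen a + size s)%N.
Proof. exact: size_cat. Qed.

Lemma pext_nil a : pext a [::] = a.
Proof. by case: a => v s; rewrite /pext cats0. Qed.

Lemma pext_cat a s t : pext a (s ++ t) = pext (pext a s) t.
Proof. by rewrite /pext catA. Qed.

Lemma path_rconsE a e : path_rcons a e = pext a [:: e].
Proof. by rewrite /path_rcons /pext cats1. Qed.

Lemma prng_pext a s : prng (pext a s) = last (prng a) (map etgt s).
Proof. exact: prng_cat. Qed.

Lemma bipath_pext a b s : bipath a b -> walk (prng a) s ->
  bipath (pext a s) (pext b s).
Proof.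
move=> [pa pb ab] ws; split; rewrite ?is_path_pext ?pa ?pb -?ab//.
by rewrite !prng_pext ab.
Qed.

Lemma bipath_sym a b : bipath a b -> bipath b a.
Proof. by case. Qed.

Lemma bipathxx a : is_path a -> bipath a a.
Proof. by []. Qed.

Lemma pcat_pext a v s x : pcat (pext a s) x = pcat a (pcat (v, s) x).
Proof. exact: pcatA. Qed.

Lemma lag_triple_pext a b v s x :
  lag_triple (pext a s) (pext b s) x = lag_triple a b (pcat (v, s) x).
Proof.
rewrite /lag_triple !(pcat_pext _ v) !plen_pext; congr (_, _, _); lia.
Qed.

Lemma pcat_inj a x y : is_path a -> prng a = gpath_src x ->
  prng a = gpath_src y -> pcat a x = pcat a y -> x = y.
Proof.
move=> pa ax ay /(pcat_split pa pa ax ay (leqnn _)) [s [aE _ ->]].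
have : size a.2 = size (a.2 ++ s) by rewrite {1}aE.
rewrite size_cat => /eqP; rewrite -[X in X == _]addn0 eqn_add2l eq_sym.
by rewrite size_eq0 => /eqP ->; rewrite ay; exact: pcat_nil.
Qed.

(** Two bipaths whose cylinders meet are comparable, with one and the same
    extension on both sides: the lag forces the two extensions to have equal
    length. *)
Lemma Zset_comparable a b c d g : bipath a b -> bipath c d ->
  (plen a <= plen c)%N -> Zset a b g -> Zset c d g ->
  exists s, [/\ walk (prng a) s, c = pext a s & d = pext b s].
Proof.
move=> [pa pb ab] [pc pd cd] lac [x [bx xa gE]] [y [bY yc]].
rewrite gE => -[eac elag ebd].
have [s [cE ws xE]] := pcat_split pa pc (esym xa) (esym yc) lac eac.
have lbd : (plen b <= plen d)%N by move: elag lac; lia.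
have bx' : prng b = gpath_src x by rewrite -ab.
have dy : prng d = gpath_src y by rewrite -cd.
have [t [dE wt xE']] := pcat_split pb pd bx' dy lbd ebd.
have sst : size s = size t.
  by move: elag; rewrite cE dE /plen /= !size_cat; lia.
exists s; split=> //; rewrite dE; congr (_, _ ++ _).
have pw v u : is_path (v, u) = walk v u by [].
have [||||||u [[]]] := @pcat_split _ (prng a, s) (prng b, t) y y; rewrite ?pw//.
- by rewrite yc -[prng (_, _)]/(last (prng a) _) -prng_pext /pext -cE.
- by rewrite -dy -[prng (_, _)]/(last (prng b) _) -prng_pext /pext -dE.
- by rewrite /plen /= sst.
- by rewrite -xE -xE'.
move=> _ tE _ _; move: sst; rewrite tE size_cat => /eqP.
rewrite -[X in X == _]addn0 eqn_add2l eq_sym size_eq0 => /eqP ->.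
by rewrite cats0.
Qed.

Lemma arrow_lagP g : exists a b x, [/\ bipath a b, is_boundary x,
  gpath_src x = prng a & arrow_val g = lag_triple a b x].
Proof.
have [a [b [x [pa pb bx [ax xb] gE]]]] := arrowP g.
by exists a, b, x; split=> //; split; rewrite // ax.
Qed.

Lemma arrow_exists a b x : bipath a b -> is_boundary x ->
  gpath_src x = prng a -> exists g, arrow_val g = lag_triple a b x.
Proof.
move=> [pa pb ab] bx xa.
have ga : is_arrow (lag_triple a b x).
  by exists a, b, x; split=> //; rewrite -ab.
by exists (GraphArrow ga).
Qed.

Lemma Zset_pext_sub a b s : bipath a b -> walk (prng a) s ->
  Zset (pext a s) (pext b s) `<=` Zset a b.
Proof. by move=> [_ _]; exact: Zset_prefix. Qed.

Definition starts_in F x :=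
  match x with
  | FinPath p => if p.2 is e :: _ then F e else False
  | InfPath f => F (f 0%N)
  end.

Lemma starts_in_cons F v e s x : starts_in F (pcat (v, e :: s) x) = F e.
Proof. by case: x. Qed.

Lemma starts_inP F x : is_boundary x -> starts_in F x ->
  exists e y, [/\ F e, is_boundary y, gpath_src y = etgt e,
    esrc e = gpath_src x & x = pcat (gpath_src x, [:: e]) y].
Proof.
case: x => [[v [|e s]]|f] //=.
  rewrite /is_path /= => -[/andP[/eqP ev ws] r] Fe.
  by exists e, (FinPath (etgt e, s)); split.
move=> bf Ff; exists (f 0%N), (InfPath (fun i => f i.+1)); split=> //=.
by congr InfPath; apply/funext => -[|i] //=; rewrite nth_nil /plen /= subn1.
Qed.

(** Removing the cylinders through [F] only constrains the first edge of the
    tail, whatever the two prefixes are; this is what makes every translation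
    between cylinders continuous. *)
Lemma ZsetFE a b F x g : bipath a b -> F `<=` out_edges (prng a) ->
  is_boundary x -> gpath_src x = prng a -> arrow_val g = lag_triple a b x ->
  ZsetF a b F g <-> ~ starts_in F x.
Proof.
move=> ab Fa bx xa gE; split=> [[_ nF] xF|xF].
  have [e [y [Fe bY ye ev xE]]] := starts_inP bx xF.
  apply: nF; exists e => //; exists y; split=> //.
    by rewrite path_rconsE prng_pext.
  by rewrite !path_rconsE (lag_triple_pext _ _ (gpath_src x)) -xE.
split=> [|[e Fe [y [bY ye gE']]]]; first by exists x.
move: ye; rewrite path_rconsE prng_pext /= => ye.
apply: xF; move: gE'; rewrite gE !path_rconsE (lag_triple_pext _ _ (prng a)).
move=> [ax _].
have we : walk (prng a) [:: e] by rewrite /= (Fa _ Fe) eqxx.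
suff -> : x = pcat (prng a, [:: e]) y by rewrite starts_in_cons.
have [pa _ _] := ab.
by apply: (pcat_inj pa) ax => //; rewrite gpath_src_pcat.
Qed.

Lemma Zset_ZsetF0 a b : ZsetF a b set0 = Zset a b.
Proof. by rewrite /ZsetF bigcup_set0 setD0. Qed.

Lemma ZsetF_lag a b F g : ZsetF a b F g ->
  exists x, [/\ is_boundary x, gpath_src x = prng a &
                arrow_val g = lag_triple a b x].
Proof. by case. Qed.

(** The first edge of [s] is not in [F], as [g] shows, and every other point of
    the longer cylinder begins with that same edge. *)
Lemma Zset_sub_ZsetF a b F s g : bipath a b -> F `<=` out_edges (prng a) ->
  walk (prng a) s -> s != [::] -> ZsetF a b F g ->
  Zset (pext a s) (pext b s) g -> Zset (pext a s) (pext b s) `<=` ZsetF a b F.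
Proof.
move=> ab Fa ws s0 gF [y [bY yas gE]] h [z [bz zas hE]].
case: s => // e s in ws s0 yas gE zas hE *.
have pw : is_path (prng a, e :: s) by [].
have pr w : gpath_src w = prng (pext a (e :: s)) ->
    prng (prng a, e :: s) = gpath_src w by rewrite prng_pext => ->.
have H w k : is_boundary w -> gpath_src w = prng (pext a (e :: s)) ->
    arrow_val k = lag_triple (pext a (e :: s)) (pext b (e :: s)) w ->
    ZsetF a b F k <-> ~ F e.
  move=> bw wE; rewrite (lag_triple_pext _ _ (prng a)) => kE.
  rewrite -(starts_in_cons F (prng a) e s w); apply: ZsetFE => //.
    by apply: pcat_boundary => //; exact: pr.
  by rewrite gpath_src_pcat//; exact: pr.
by apply/(H z h bz zas hE); apply/(H y g bY yas gE).
Qed.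

End PathsAndArrows.

(** * The topology of the graph groupoid *)

Section GraphTopologyFacts.
Variable E : digraph.
Implicit Types (a b c d : prepath E) (s t : seq (edge E)) (x y z : gpath E).
Implicit Types (g h : graph_arrow E) (F : set (edge E)).

Lemma ZsetF_open a b F : bipath a b -> finite_set F ->
  F `<=` out_edges (prng a) -> open (ZsetF a b F).
Proof.
move=> [pa pb ab] finF Fa; exists [set ZsetF a b F]; last first.
  by rewrite bigcup_set1.
by move=> _ ->; exists a, b, F; split.
Qed.

Lemma Zset_open a b : bipath a b -> open (Zset a b).
Proof.
by move=> ab; rewrite -Zset_ZsetF0; apply: ZsetF_open => // ? [].
Qed.

(** A neighbourhood base at [g] can be chosen adapted to any presentation of
    [g], by letting the prefixes grow along the tail. *)
Lemma nbhs_arrow a b x g (N : set (graph_arrow E)) : bipath a b ->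
  is_boundary x -> gpath_src x = prng a -> arrow_val g = lag_triple a b x ->
  nbhs g N -> exists s y F, [/\ walk (prng a) s, x = pcat (prng a, s) y,
    is_boundary y, gpath_src y = prng (pext a s) &
    [/\ finite_set F, F `<=` out_edges (prng (pext a s)), ~ starts_in F y &
        ZsetF (pext a s) (pext b s) F `<=` N]].
Proof.
move=> ab bx xa gE; rewrite nbhsE => -[_ [[D DZ <-] [U DU Ug]] UN].
have [c [d [F [pc pd cd [finF Fc] UE]]]] := DZ _ DU.
have {UN} cdN : ZsetF c d F `<=` N.
  by move=> h hF; apply: UN; exists U; rewrite // UE.
move: Ug; rewrite UE => {D DZ DU U UE} gF.
have bcd : bipath c d by [].
have gab : Zset a b g by exists x.
have gcd : Zset c d g by case: gF.
have [lca|/ltnW lac] := leqP (plen c) (plen a).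
  have [t [wt aE bE]] := Zset_comparable bcd ab lca gcd gab.
  exists [::], x; rewrite -[x in x = _]pcat_nil !pext_nil xa.
  have [t0|t0] := eqVneq t [::].
    move: aE bE; rewrite t0 !pext_nil => aE bE; subst c d.
    by exists F; split=> //; split=> //; exact/(ZsetFE ab Fc bx xa gE).
  exists set0; split=> //; split=> //; first by case: (x) => [[? []]|] *.
  rewrite Zset_ZsetF0 aE bE; apply: subset_trans cdN.
  by apply: Zset_sub_ZsetF gF _ => //; rewrite -aE -bE.
have [t [wt cE dE]] := Zset_comparable ab bcd lac gab gcd.
have [y [bY yc gE']] := gcd.
exists t, y, F; rewrite -cE -dE; split=> //; last first.
  by split=> //; apply/(ZsetFE bcd Fc bY yc gE').
have [pa _ _] := ab.
apply: (pcat_inj pa) => //.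
  by rewrite gpath_src_pcat// -[prng _]/(last _ _) -prng_pext -cE.
by move: gE'; rewrite gE cE dE (lag_triple_pext _ _ (prng a)) => -[].
Qed.

Lemma nbhs_ZsetF a b F x g : bipath a b -> finite_set F ->
  F `<=` out_edges (prng a) -> is_boundary x -> gpath_src x = prng a ->
  ~ starts_in F x -> arrow_val g = lag_triple a b x -> nbhs g (ZsetF a b F).
Proof.
move=> ab finF Fa bx xa xF gE; apply: open_nbhs_nbhs; split.
  exact: ZsetF_open.
by apply/(ZsetFE ab Fa bx xa gE).
Qed.

(** A point outside [Zset a b] whose tail is long enough has a neighbourhood
    [Zset c d] with [c] at least as long as [a], which is disjoint from [Zset a b] as
    comparable cylinders are nested.  Otherwise the range is a finite
    path, and it suffices to exclude the one edge by which [a] continues it. *)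
Lemma Zset_closed a b : bipath a b -> closed (Zset a b).
Proof.
move=> ab; rewrite -[Zset a b]setCK; apply: open_closedC.
rewrite openE => g /= gab.
have [c [d [x [cd bx xc gE]]]] := arrow_lagP g.
have subC s : walk (prng c) s -> (plen a <= plen (pext c s))%N ->
    Zset (pext c s) (pext d s) g ->
    Zset (pext c s) (pext d s) `<=` ~` Zset a b.
  move=> ws lac gs h hcd hab; apply: gab.
  have cds := bipath_pext cd ws.
  have [t [wt cE dE]] := Zset_comparable ab cds lac hab hcd.
  by move: gs; rewrite cE dE; apply: Zset_pext_sub.
have [[y [s [ws xE bY ys las]]]|noext] := pselect (exists y s,
    [/\ walk (prng c) s, x = pcat (prng c, s) y, is_boundary y,
        gpath_src y = prng (pext c s) & (plen a <= plen (pext c s))%N]).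
  have gs : Zset (pext c s) (pext d s) g.
    by exists y; rewrite (lag_triple_pext _ _ (prng c)) -xE.
  apply: filterS (subC s ws las gs) _; apply: open_nbhs_nbhs; split=> //.
  by apply: Zset_open; exact: bipath_pext.
case: x => [[v s]|f] in bx xc gE noext *; last first.
  case: noext; exists (InfPath (fun i => f (i + plen a)%N)).
  exists (mkseq f (plen a)).
  have fE : InfPath f = pcat (prng c, mkseq f (plen a))
      (InfPath (fun i => f (i + plen a)%N)).
    congr InfPath; apply/funext => i; rewrite /plen /= size_mkseq.
    have [il|il] := ltnP i (size a.2); first by rewrite nth_mkseq.
    by rewrite nth_default ?size_mkseq// subnK.
  have wf n : walk (prng c) (mkseq f n) /\
      last (prng c) (map etgt (mkseq f n)) = esrc (f n).
    elim: n => [|n [wn ln]]; first by rewrite /mkseq.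
    rewrite mkseqS -cats1 walk_cat wn map_cat last_cat ln /= eqxx /=.
    by split=> //; exact: bx.
  have [wa la] := wf (plen a).
  split=> //; first by rewrite prng_pext la.
  by rewrite plen_pext size_mkseq leq_addl.
have vc : v = prng c by [].
rewrite {}vc in bx xc gE noext.
set p := pext c s; set q := pext d s; have [ws bs] := bx.
have pq : bipath p q by exact: bipath_pext.
have gE' : arrow_val g = lag_triple p q (FinPath (prng p, [::])).
  by rewrite (lag_triple_pext _ _ (prng c)) /= cats0.
have bp : is_boundary (FinPath (prng p, [::])).
  by split=> //; rewrite /p prng_pext.
(* The next edge of [a] after [p], if [a] extends [p] at all. *)
pose F := [set e | exists t, a = pext p (e :: t) /\ esrc e = prng p].
have finF : finite_set F.
  apply: (@sub_finite_set _ _ [set` drop (size p.2) a.2]).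
    by move=> e [t [-> _]] /=; rewrite drop_size_cat// inE eqxx.
  exact: finite_seq.
have Fp : F `<=` out_edges (prng p) by move=> e [t [_ ?]].
apply: filterS (nbhs_ZsetF pq finF Fp bp _ _ gE') => //.
move=> h hF hab.
have [y [bY yp hE]] := ZsetF_lag hF.
have hpq : Zset p q h by exists y.
have lpa : (plen p <= plen a)%N.
  rewrite leqNgt; apply/negP => /ltnW lap; apply: noext.
  by exists (FinPath (prng p, [::])), s; split=> //=; rewrite cats0.
have [[|e t] [wt aE bE]] := Zset_comparable pq ab lpa hpq hab.
  apply: gab; rewrite aE bE !pext_nil.
  by exists (FinPath (prng p, [::])).
have Fe : F e by exists t; split=> //; case/andP: wt => /eqP.
have [_ nF] := hF; apply: nF; exists e => //; rewrite !path_rconsE.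
move: hab; rewrite aE bE -[e :: t]cat1s !pext_cat.
have we : walk (prng p) [:: e] by rewrite /= (Fp _ Fe) eqxx.
apply: Zset_pext_sub; first exact: bipath_pext.
by rewrite prng_pext; case/andP: wt.
Qed.

Lemma ZsetF_closed a b F : bipath a b -> finite_set F ->
  F `<=` out_edges (prng a) -> closed (ZsetF a b F).
Proof.
move=> ab finF Fa; rewrite /ZsetF setDE; apply: closedI.
  exact: Zset_closed.
apply: open_closedC; apply: bigcup_open => e Fe; apply: Zset_open.
by rewrite !path_rconsE; apply: bipath_pext => //=; rewrite (Fa _ Fe) eqxx.
Qed.

End GraphTopologyFacts.

(** * Compactness of cylinders *)

Lemma dependent_choice_seq (T : Type) (P : seq T -> Prop) : P [::] ->
  (forall s, P s -> exists e, P (rcons s e)) ->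
  exists f : nat -> T, forall n, P (mkseq f n).
Proof.
move=> P0 PS; have [e0 _] := PS _ P0.
have /choice[nxt nxtP] : forall s, exists e, P s -> P (rcons s e).
  by move=> s; have [/PS[e]|] := pselect (P s); [exists e|exists e0].
pose u := fix u n := if n is m.+1 then rcons (u m) (nxt (u m)) else [::].
exists (nxt \o u) => n; suff -> : mkseq (nxt \o u) n = u n.
  by elim: n => //= n; exact: nxtP.
by elim: n => // n IHn; rewrite mkseqS IHn.
Qed.

Section Compactness.
Variable E : digraph.
Implicit Types (a b c d : prepath E) (s t : seq (edge E)) (x y z : gpath E).
Implicit Types (g h : graph_arrow E) (F : set (edge E)).

Lemma last_mkseq v f n : walk v (mkseq f n.+1) ->
  last v (map etgt (mkseq f n)) = esrc (f n) :> vertex E.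
Proof. by rewrite mkseqS -cats1 walk_cat /= => /andP[_ /andP[/eqP]]. Qed.

Lemma walk_mkseq_boundary v (f : nat -> edge E) :
  (forall n, walk v (mkseq f n)) ->
  is_boundary (InfPath f) /\ esrc (f 0%N) = v.
Proof.
move=> wf; split=> [i|]; last by have /andP[/eqP] := wf 1%N.
have := last_mkseq (wf i.+2); have := last_mkseq (wf i.+1).
by rewrite mkseqS map_rcons last_rcons.
Qed.

Lemma InfPath_drop v f n :
  InfPath f = pcat (v, mkseq f n) (InfPath (fun i => f (i + n)%N)) :> gpath E.
Proof.
congr InfPath; apply/funext => i; rewrite /plen /= size_mkseq.
have [il|il] := ltnP i n; first by rewrite nth_mkseq.
by rewrite nth_default ?size_mkseq// subnK.
Qed.

Lemma pcat_InfPath_mkseq v s f y : InfPath f = pcat (v, s) y ->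
  s = mkseq f (size s).
Proof.
case: y => // k [e]; apply: (@eq_from_nth _ (f 0%N)) => [|i il].
  by rewrite size_mkseq.
by rewrite nth_mkseq// e; exact: set_nth_default.
Qed.

(** An ultrafilter on [Zset a b] decides, edge by edge, a longest extension
    [s] such that the cylinder over [s] is large.  Either this goes on forever
    and the resulting infinite path is the limit, or it stops at some [s]; the
    end of [s] is then not regular, because a regular vertex splits its
    cylinder into finitely many pieces, and [s] itself is the limit. *)
Lemma Zset_compact a b : bipath a b -> compact (Zset a b).
Proof.
move=> ab; have [pa _ _] := ab; rewrite compact_ultra => U UU Uab.
pose P s := walk (prng a) s /\ U (Zset (pext a s) (pext b s)).
have P0 : P [::] by split=> //; rewrite !pext_nil.
have [PS|/existsNP[s /not_implyP[[ws Us] noe]]] :=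
    pselect (forall s, P s -> exists e, P (rcons s e)).
  have [f Pf] := dependent_choice_seq P0 PS.
  have [bf fa] := @walk_mkseq_boundary (prng a) f (fun n => (Pf n).1).
  have [g gE] := arrow_exists ab bf fa.
  exists g; split; first by exists (InfPath f).
  move=> N /(nbhs_arrow ab bf fa gE)[s [y [F [ws fE bY ys [finF Fs yF sN]]]]].
  pose n := size s.
  have sE : s = mkseq f n := pcat_InfPath_mkseq fE.
  apply: filterS (Pf n.+1).2.
  rewrite mkseqS -cats1 -sE !pext_cat; apply: subset_trans sN.
  have abs := bipath_pext ab ws.
  have gs : arrow_val g = lag_triple (pext a s) (pext b s) y.
    by rewrite (lag_triple_pext _ _ (prng a)) -fE.
  have wn : walk (prng (pext a s)) [:: f n].
    have := (Pf n.+1).1.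
    by rewrite mkseqS -cats1 -sE walk_cat prng_pext => /andP[].
  apply: (Zset_sub_ZsetF abs Fs wn) => //.
    exact/(ZsetFE abs Fs bY ys gs).
  rewrite -!pext_cat cats1 sE -mkseqS.
  exists (InfPath (fun i => f (i + n.+1)%N)); split.
  - by move=> i; exact: bf.
  - rewrite prng_pext mkseqS map_rcons last_rcons; exact/esym/bf.
  - by rewrite (lag_triple_pext _ _ (prng a)) -InfPath_drop gE.
have abs := bipath_pext ab ws.
set p := pext a s in abs Us *; set q := pext b s in abs Us *.
(* No cylinder one edge further is large, so their complements are. *)
have small e : esrc e = prng p -> U (~` Zset (pext p [:: e]) (pext q [:: e])).
  move=> ep; have [Ue|//] := in_ultra_setVsetC
    (Zset (pext p [:: e]) (pext q [:: e])) UU.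
  case: noe; exists e; split; last by rewrite -cats1 !pext_cat.
  by rewrite -cats1 walk_cat ws /= -prng_pext -/p ep eqxx.
have smallF F : finite_set F -> F `<=` out_edges (prng p) -> U (ZsetF p q F).
  move=> finF Fp; rewrite /ZsetF setDE setC_bigcup; apply: filterI => //.
  rewrite -(fset_setK finF); apply: filter_bigI => e.
  by rewrite in_fset_set// inE => /Fp ep; rewrite !path_rconsE; apply: small.
have bp : is_boundary (FinPath (prng p, [::])).
  split=> //; apply/or_asboolP; rewrite -[_ || _]negbK negb_or.
  apply/negP => /andP[/asboolPn nsink /asboolPn/contrapT fin].
  have /filter_ex[g [[y [bY yp gE]] gF]] := smallF _ fin (fun=> id).
  have outF : starts_in (out_edges (prng p)) y.
    case: y bY yp {gE} => [[v [|e t]] [wt r]|//] yp.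
      have vp : v = prng p by [].
      by case: r; rewrite -[prng _]/v vp // => /(_ fin).
    by case/andP: wt => /eqP ev _; rewrite /out_edges /= ev.
  by have /(ZsetFE abs (fun=> id) bY yp gE) : ZsetF p q (out_edges (prng p)) g
    by split=> //; exists y.
have [g gE] := arrow_exists abs bp erefl.
have gab : Zset p q g by exists (FinPath (prng p, [::])).
exists g; split; first exact: Zset_pext_sub gab.
move=> N /(nbhs_arrow abs bp erefl gE)[t [y [F [_ yE _ _ [finF Fp _ pN]]]]].
have t0 : t = [::] by case: t y yE {Fp pN} => [|e t] [] //= [].
move: pN Fp; rewrite t0 !pext_nil => pN Fp.
exact: filterS pN (smallF _ finF Fp).
Qed.

End Compactness.

(** * Source, range and inverse; open bisections *)

(** An open continuous injection is a homeomorphism onto its image, which is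
    open; so that image itself serves as the open set cutting the unit space. *)
Lemma unit_homeo_open_map (G : groupoid) (phi : G -> G) (U : set G) :
  open U -> continuous phi -> (forall N, open N -> open (phi @` N)) ->
  range phi `<=` @unit_space G -> {in U &, injective phi} -> unit_homeo phi U.
Proof.
move=> oU cphi ophi uphi injphi.
have /choice[psi psiP] : forall y, exists u, (phi @` U) y -> U u /\ phi u = y.
  move=> y; have [[u Uu <-]|ny] := pselect ((phi @` U) y); first by exists u.
  by exists y => /ny.
have VE : phi @` U `&` @unit_space G = phi @` U.
  by apply/setIidPl => _ [u Uu <-]; apply: uphi; exists u.
have phiK : {in U, cancel phi psi}.
  move=> u; rewrite inE => Uu; have [|Upsi ePsi] := psiP (phi u).
    by exists u.
  by apply: injphi; rewrite ?inE.
exists (phi @` U), psi; rewrite VE; split=> //.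
- exact: ophi.
- by split=> [|//|//] u Uu; exists u.
- exact: continuous_subspaceT.
apply/subspace_continuousP => _ [u Uu <-].
rewrite /from_subspace phiK ?inE// => N Nu.
rewrite /nbhs /= /within /=; have : nbhs u (N `&` U).
  by apply: filterI => //; apply: open_nbhs_nbhs.
rewrite nbhsE => -[W [oW Wu] WNU].
apply: (filterS _ (open_nbhs_nbhs (conj (ophi _ oW) _))); last by exists u.
move=> _ [w Ww <-] _ /=; have [Nw Uw] := WNU _ Ww.
by rewrite phiK ?inE.
Qed.

Section GroupoidMaps.
Variable E : digraph.
Local Notation G := (graph_groupoid E).
Implicit Types (a b c d : prepath E) (s t : seq (edge E)) (x y z : gpath E).
Implicit Types (g h : graph_arrow E) (F : set (edge E)).

Lemma ga_inv_lag a b x g : arrow_val g = lag_triple a b x ->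
  arrow_val (ga_inv g) = lag_triple b a x.
Proof. by rewrite /ga_inv /= /ga_src /ga_rng /ga_lag => -> /=; rewrite opprB. Qed.

Lemma ga_unit_src_lag a b x g : arrow_val g = lag_triple a b x ->
  arrow_val (ga_unit_src g) = lag_triple b b x.
Proof. by rewrite /= /ga_src /lag_triple subrr => ->. Qed.

Lemma ga_invK : involutive (@ga_inv E).
Proof. by move=> g; apply: arrow_eq => //; rewrite /ga_lag /= opprK. Qed.

Lemma ga_unit_rng_inv g : ga_unit_rng g = ga_unit_src (ga_inv g).
Proof. exact: arrow_inj. Qed.

Lemma ga_inv_continuous : continuous (@ga_inv E).
Proof.
move=> g N; have [a [b [x [ab bx xa gE]]]] := arrow_lagP g.
have ba := bipath_sym ab; have gV := ga_inv_lag gE; have [_ _ eab] := ab.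
have xb : gpath_src x = prng b by rewrite -eab.
case/(nbhs_arrow ba bx xb gV) => s [y [F [ws xE bY ys [finF Fs yF sN]]]].
have bas := bipath_pext ba ws; have abs := bipath_sym bas.
have eas : prng (pext a s) = prng (pext b s) by case: abs.
have gs : arrow_val g = lag_triple (pext a s) (pext b s) y.
  by rewrite (lag_triple_pext _ _ (prng b)) -xE.
have Fs' : F `<=` out_edges (prng (pext a s)) by rewrite eas.
have ys' : gpath_src y = prng (pext a s) by rewrite eas.
apply: filterS (nbhs_ZsetF abs finF Fs' bY ys' yF gs).
move=> h hF; apply: sN; have [z [bz zs hE]] := ZsetF_lag hF.
have zs' : gpath_src z = prng (pext b s) by rewrite -eas.
apply/(ZsetFE bas Fs bz zs' (ga_inv_lag hE)).
exact/(ZsetFE abs Fs' bz zs hE).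
Qed.

Lemma ga_unit_src_continuous : continuous (@ga_unit_src E).
Proof.
move=> g N; have [a [b [x [ab bx xa gE]]]] := arrow_lagP g.
have [pa pb eab] := ab; have bb := bipathxx pb.
have xb : gpath_src x = prng b by rewrite -eab.
case/(nbhs_arrow bb bx xb (ga_unit_src_lag gE)).
move=> s [y [F [ws xE bY ys [finF Fs yF sN]]]].
have bs := bipath_pext bb ws; have eas : prng (pext a s) = prng (pext b s).
  by rewrite !prng_pext eab.
have abs : bipath (pext a s) (pext b s) by apply: bipath_pext; rewrite // eab.
have gs : arrow_val g = lag_triple (pext a s) (pext b s) y.
  by rewrite (lag_triple_pext _ _ (prng b)) -xE.
have Fs' : F `<=` out_edges (prng (pext a s)) by rewrite eas.
have ys' : gpath_src y = prng (pext a s) by rewrite eas.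
apply: filterS (nbhs_ZsetF abs finF Fs' bY ys' yF gs).
move=> h hF; apply: sN; have [z [bz zs hE]] := ZsetF_lag hF.
have zs' : gpath_src z = prng (pext b s) by rewrite -eas.
apply/(ZsetFE bs Fs bz zs' (ga_unit_src_lag hE)).
exact/(ZsetFE abs Fs' bz zs hE).
Qed.

Lemma ga_unit_rng_continuous : continuous (@ga_unit_rng E).
Proof.
have -> : @ga_unit_rng E = @ga_unit_src E \o @ga_inv E.
  by apply/funext => g; exact: ga_unit_rng_inv.
move=> g; apply: continuous_comp; first exact: ga_inv_continuous.
exact: ga_unit_src_continuous.
Qed.

(** The source map sends the basic set of [(a, b, F)] onto the one of
    [(b, b, F)]. *)
Lemma ga_unit_src_open (N : set (graph_arrow E)) : open N ->
  open (@ga_unit_src E @` N).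
Proof.
rewrite !openE => oN _ [g /oN Ng <-].
have [a [b [x [ab bx xa gE]]]] := arrow_lagP g.
case: (nbhs_arrow ab bx xa gE Ng).
move=> s [y [F [ws xE bY ys [finF Fs yF sN]]]].
have abs := bipath_pext ab ws; have [pa pb eab] := abs.
have ys' : gpath_src y = prng (pext b s) by rewrite -eab.
have gs : arrow_val g = lag_triple (pext a s) (pext b s) y.
  by rewrite (lag_triple_pext _ _ (prng a)) -xE.
have Fs' : F `<=` out_edges (prng (pext b s)) by rewrite -eab.
have bs := bipathxx pb.
apply: filterS (nbhs_ZsetF bs finF Fs' bY ys' yF (ga_unit_src_lag gs)).
move=> h hF; have [z [bz zs hE]] := ZsetF_lag hF.
rewrite -eab in zs.
have [k kE] := arrow_exists abs bz zs.
exists k; first apply: sN.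
  apply/(ZsetFE abs Fs bz zs kE).
  by rewrite eab in zs; apply/(ZsetFE bs Fs' bz zs hE).
by apply: arrow_inj; rewrite (ga_unit_src_lag kE) hE.
Qed.

Lemma ga_unit_src_inj a b : bipath a b -> {in Zset a b &, injective (@ga_unit_src E)}.
Proof.
move=> [pa pb ab] g h /[!inE] -[x [bx xa gE]] [y [bY ya hE]].
move=> /(congr1 (@arrow_val E)).
rewrite (ga_unit_src_lag gE) (ga_unit_src_lag hE) => -[exy _].
apply: arrow_inj; rewrite gE hE; congr lag_triple.
by apply: (pcat_inj pb) exy; rewrite -ab.
Qed.

Lemma ga_inv_Zset a b g : Zset a b g -> prng a = prng b -> Zset b a (ga_inv g).
Proof.
by move=> [x [bx xa /ga_inv_lag gE]] ab; exists x; split; rewrite // -ab.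
Qed.

Lemma ga_unit_rng_inj a b : bipath a b -> {in Zset a b &, injective (@ga_unit_rng E)}.
Proof.
move=> ab g h /[!inE] gZ hZ; rewrite !ga_unit_rng_inv => e.
have [_ _ eab] := ab; apply: (can_inj ga_invK).
by apply: (ga_unit_src_inj (bipath_sym ab)) e; rewrite inE; apply: ga_inv_Zset.
Qed.

Lemma open_bisection_sub (a b : prepath E) (U : set G) : bipath a b ->
  open U -> U `<=` Zset a b -> open_bisection U.
Proof.
move=> ab oU Uab.
have Uin g : g \in U -> g \in Zset a b by rewrite !inE; apply: Uab.
have rngE : @grng G = @ga_unit_src E \o @ga_inv E.
  by apply/funext => g; exact: ga_unit_rng_inv.
split=> //; apply: unit_homeo_open_map => //.
- exact: ga_unit_src_continuous.
- exact: ga_unit_src_open.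
- by move=> g h /Uin gU /Uin hU; apply: ga_unit_src_inj gU hU.
- exact: ga_unit_rng_continuous.
- move=> N oN; rewrite rngE -image_comp.
  apply: ga_unit_src_open; rewrite (_ : _ @` N = @ga_inv E @^-1` N).
    by apply: open_comp => // g _; exact: ga_inv_continuous.
  apply/seteqP; split=> [_ [g Ng <-]|g Ng]; first by rewrite /preimage /= ga_invK.
  by exists (ga_inv g) => //; rewrite ga_invK.
- by move=> _ [g _ <-]; exists (ginv g) => //; exact: gsrc_inv.
- by move=> g h /Uin gU /Uin hU; apply: ga_unit_rng_inj gU hU.
Qed.

End GroupoidMaps.

(** * The Steinberg algebra as locally constant functions with compact support *)

(** Compactness as an induction principle: an ideal of sets that contains a
    neighbourhood of each point of [K] contains [K]; otherwise the complements
    of its members, relative to [K], would form a filter without cluster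
    point. *)
Lemma compact_ideal_ind (T : topologicalType) (K : set T) (P : set (set T)) :
  compact K -> P set0 -> (forall A B, A `<=` B -> P B -> P A) ->
  (forall A B, P A -> P B -> P (A `|` B)) ->
  (forall x, K x -> exists2 N, nbhs x N & P N) -> P K.
Proof.
move=> cK P0 PS PU PN; apply: contrapT => nPK.
pose F : set_system T := [set V | P (K `\` V)].
have FF : ProperFilter F.
  split; first by rewrite /F /= setD0.
  split; first by rewrite /F /= setDT.
  - by move=> A B FA FB; rewrite /F /= setDIr; exact: PU.
  - by move=> A B AB; apply: PS; exact: setDS.
have FK : F K by rewrite /F /= setDv.
have [x [Kx xF]] := cK F FF FK.
have [N xN PN'] := PN _ Kx.
have FN : F (~` N) by apply: PS PN' => y [_ /contrapT].
by have [y []] := xF _ _ FN xN.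
Qed.

Section SteinbergElements.
Variables (E : digraph) (S : comNzSemiRingType).
Local Notation G := (graph_groupoid E).
Local Notation A := (@steinberg G S).
Local Notation char := (@char_fun G S).
Implicit Types (a b c d : prepath E) (g h : graph_arrow E).
Implicit Types (f k : graph_arrow E -> S) (U V : set (graph_arrow E)).

(** Continuity for the discrete topology on [S]. *)
Definition locally_constant f := forall g, nbhs g [set h | f h = f g].

(** A pair that is not a [bipath] covers nothing, so that lists of pairs can be
    transformed entry by entry without checking them. *)
Fixpoint covered (L : seq (prepath E * prepath E)) g : Prop :=
  if L is ab :: L' then (bipath ab.1 ab.2 /\ Zset ab.1 ab.2 g) \/ covered L' g
  else False.

Definition covered_support f := exists L, forall g, f g <> 0 -> covered L g.

Lemma covered_cat L L' g : covered (L ++ L') g <-> covered L g \/ covered L' g.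
Proof. by elim: L => //= [|ab L ->]; tauto. Qed.

Lemma continuous_locally_constant f :
  continuous (f : G -> discrete_topology S) <-> locally_constant f.
Proof.
split=> cf g; first exact: cf (discrete_set1 (f g : discrete_topology S)).
by move=> N Nf; apply: filterS (cf g) => h /= ->; exact: nbhs_singleton Nf.
Qed.

Lemma subsemimodule_steinberg : subsemimodule A.
Proof.
split=> [|f k Af Ak|c f Af] M MP; have [[[M0 MD MZ] _] _] := MP.
- exact: M0.
- by apply: MD; [exact: Af|exact: Ak].
- by apply: MZ; exact: Af.
Qed.

Lemma nbhs_basic g (N : set (graph_arrow E)) : nbhs g N -> exists a b F,
  [/\ bipath a b, finite_set F, F `<=` out_edges (prng a), ZsetF a b F g &
      ZsetF a b F `<=` N].
Proof.
have [a [b [x [ab bx xa gE]]]] := arrow_lagP g.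
case/(nbhs_arrow ab bx xa gE) => s [y [F [ws xE bY ys [finF Fs yF sN]]]].
have abs := bipath_pext ab ws; exists (pext a s), (pext b s), F; split=> //.
apply/(ZsetFE abs Fs bY ys) => //.
by rewrite (lag_triple_pext _ _ (prng a)) -xE.
Qed.

(** A compact open set is a finite union of basic sets contained in it; these
    are closed, and each of them lies in a cylinder. *)
Lemma compact_open_covered U : open U -> compact U ->
  closed U /\ exists L, forall g, U g -> covered L g.
Proof.
move=> oU cU.
split.
  suff : [set V | closure V `<=` U] U by move=> /closure_id -> //; exact: closed_closure.
  apply: compact_ideal_ind => //=.
  - by rewrite closure0.
  - by move=> V W /closureS VW; exact: subset_trans.
  - by move=> V W VU WU; rewrite closureU => g [/VU|/WU].
  move=> g Ug; have /nbhs_basic : nbhs g U by apply: open_nbhs_nbhs.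
  move=> [a [b [F [ab finF Fa gF FU]]]]; exists (ZsetF a b F).
    by apply: open_nbhs_nbhs; split=> //; exact: ZsetF_open.
  by rewrite -(closure_id _).1//; exact: ZsetF_closed.
apply: (compact_ideal_ind (P := [set V | exists L, V `<=` covered L])) => //=.
- by exists [::].
- by move=> V W VW [L WL]; exists L; exact: subset_trans WL.
- move=> V W [L VL] [L' WL']; exists (L ++ L') => g VWg.
  by apply/covered_cat; case: VWg => [/VL|/WL']; tauto.
move=> g Ug; have [a [b [x [ab bx xa gE]]]] := arrow_lagP g.
exists (Zset a b); last by exists [:: (a, b)] => h hab; left.
by apply: open_nbhs_nbhs; split; [exact: Zset_open|exists x].
Qed.

Lemma char_funE U g : char U g = if g \in U then 1 else 0.
Proof. by rewrite /char_fun; case: ifP. Qed.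

Lemma locally_constant_char U : open U -> closed U ->
  locally_constant (char U).
Proof.
move=> oU cU g; have [Ug|nUg] := pselect (U g).
  apply: filterS (open_nbhs_nbhs (conj oU Ug)) => h Uh /=.
  by rewrite !char_funE !mem_set.
apply: filterS (open_nbhs_nbhs (conj (closed_openC cU) nUg)) => h nUh /=.
by rewrite !char_funE !memNset.
Qed.

Lemma steinberg_locally_constant f :
  A f -> locally_constant f /\ covered_support f.
Proof.
pose M : set (G -> S) := [set f | locally_constant f /\ covered_support f].
suff : A `<=` M by apply.
apply: smallest_sub; first split; first split.
- by split=> [g|]; [exact: filterE|exists [::] => g /(_ erefl)].
- move=> f1 f2 [c1 [L1 s1]] [c2 [L2 s2]]; split.
    move=> g; apply: filterS (filterI (c1 g) (c2 g)) => h [/= e1 e2].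
    by rewrite /= !addrfctE e1 e2.
  exists (L1 ++ L2) => g fg; apply/covered_cat.
  have [f1g|/eqP/s1] := eqVneq (f1 g) 0; last by left.
  have [f2g|/eqP/s2] := eqVneq (f2 g) 0; last by right.
  by case: fg; rewrite addrfctE f1g f2g addr0.
- move=> c f1 [c1 [L s1]]; split=> [g|].
    by apply: filterS (c1 g) => h /= ->.
  by exists L => g cf; apply: s1 => f1g; apply: cf; rewrite f1g mulr0.
- by move=> f1 [/continuous_locally_constant].
move=> _ [U [[oU _ _] cU] <-].
have [clU [L UL]] := compact_open_covered oU cU.
split; first exact: locally_constant_char.
by exists L => g; rewrite char_funE; case: ifP => // /set_mem /UL.
Qed.

Lemma char_fun_steinberg a b U : bipath a b -> U `<=` Zset a b ->
  open U -> closed U -> A (char U).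
Proof.
move=> ab Uab oU cU; apply: sub_gen_smallest; exists U => //; split.
  exact: open_bisection_sub Uab.
exact: subclosed_compact cU (Zset_compact ab) Uab.
Qed.

Lemma char_Zset_steinberg a b : bipath a b -> A (char (Zset a b)).
Proof.
move=> ab; apply: (char_fun_steinberg ab) => //; first exact: Zset_open.
exact: Zset_closed.
Qed.

Lemma locally_constant_preimage f (P : set S) : locally_constant f ->
  open [set g | P (f g)].
Proof.
move=> cf; rewrite openE => g /= Pg.
by apply: filterS (cf g) => h /= ->.
Qed.

Lemma locally_constant_preimage_closed f (P : set S) : locally_constant f ->
  closed [set g | P (f g)].
Proof.
move=> cf; rewrite -[X in closed X]setCK; apply: open_closedC.
exact: (locally_constant_preimage (~` P)).
Qed.

Definition restrict_fun f U g : S := if g \in U then f g else 0.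

Lemma restrict_locally_constant f U : locally_constant f -> open U ->
  closed U -> locally_constant (restrict_fun f U).
Proof.
move=> cf oU cU g; have cU' := locally_constant_char oU cU.
apply: filterS (filterI (cf g) (cU' g)) => h /= [e].
rewrite !char_funE /restrict_fun e; case: (h \in U) (g \in U) => [] [] //.
  by move/eqP; rewrite oner_eq0.
by move/esym/eqP; rewrite oner_eq0.
Qed.

Lemma restrict_split f U : f = restrict_fun f U + restrict_fun f (~` U).
Proof.
apply/funext => g; rewrite addrfctE /restrict_fun in_setC.
by case: (g \in U); rewrite /= ?addr0 ?add0r.
Qed.

(** By compactness [f] takes finitely many values; the level set of a nonzero
    value is a compact open bisection, being a clopen part of a cylinder. *)
Lemma locally_constant_steinberg1 a b f : bipath a b -> locally_constant f ->
  (forall g, f g <> 0 -> Zset a b g) -> A f.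
Proof.
move=> ab cf fab.
have [l fl] : exists l : seq S, forall g, f g <> 0 -> f g \in l.
  suff [l fl] : exists l : seq S, forall g, Zset a b g -> f g \in l.
    by exists l => g /fab/fl.
  apply: (compact_ideal_ind (Zset_compact ab)
    (P := [set V | exists l, forall g, V g -> f g \in l])) => //=.
  - by exists [::].
  - by move=> V W VW [l Wl]; exists l => g /VW/Wl.
  - move=> V W [l Vl] [l' Wl']; exists (l ++ l') => g.
    by rewrite mem_cat => -[/Vl ->//|/Wl' ->]; rewrite orbT.
  move=> g _; exists [set h | f h = f g]; first exact: cf.
  by exists [:: f g] => h ->; exact: mem_head.
have [A0 AD AZ] := subsemimodule_steinberg.
elim: l f cf fab fl => [|c l IHl] f cf fab fl.
  suff -> : f = 0 by exact: A0.
  by apply/funext => g; apply/eqP/contraT => /eqP/fl.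
pose U := [set g | [set c] (f g)].
have oU : open U by exact: locally_constant_preimage.
have cU : closed U by exact: locally_constant_preimage_closed.
suff [fU fnU] : A (restrict_fun f U) /\ A (restrict_fun f (~` U)).
  by rewrite (restrict_split f U); exact: AD.
split.
  have [c0|c0] := eqVneq c 0.
    suff -> : restrict_fun f U = 0 by exact: A0.
    apply/funext => g; rewrite /restrict_fun; case: ifP => // /set_mem /= ->.
    exact: c0.
  have -> : restrict_fun f U = fun g => c * char U g.
    apply/funext => g; rewrite char_funE /restrict_fun; case: ifP => [|_].
      by move/set_mem => /= ->; rewrite mulr1.
    by rewrite mulr0.
  apply: AZ; apply: (char_fun_steinberg ab) => // g /= fg.
  by apply: fab; rewrite fg; exact/eqP.
apply: IHl.
- exact: restrict_locally_constant cf (closed_openC cU) (open_closedC oU).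
- by move=> g; rewrite /restrict_fun; case: ifP => // _ /fab.
- move=> g; rewrite /restrict_fun; case: ifP => // /set_mem fgc /fl.
  by rewrite inE => /predU1P[].
Qed.

(** Together with [steinberg_locally_constant], this identifies the algebra
    with the locally constant functions of compact support.  The support is
    cut along one cylinder of the covering at a time. *)
Lemma locally_constant_steinberg f :
  locally_constant f -> covered_support f -> A f.
Proof.
move=> cf [L fL]; have [A0 AD _] := subsemimodule_steinberg.
elim: L f cf fL => [|[a b] L IHL] f cf fL.
  suff -> : f = 0 by exact: A0.
  by apply/funext => g; apply/eqP/contraT => /eqP/fL.
have [ab|nab] := pselect (bipath a b); last first.
  by apply: IHL => // g /fL [[/nab]|].
have oab := Zset_open ab; have cab := Zset_closed ab.
rewrite (restrict_split f (Zset a b)); apply: AD.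
  apply: (locally_constant_steinberg1 ab).
    exact: restrict_locally_constant.
  by move=> g; rewrite /restrict_fun; case: ifP => // /set_mem.
apply: IHL.
  exact: restrict_locally_constant cf (closed_openC cab) (open_closedC oab).
by move=> g; rewrite /restrict_fun; case: ifP => // /set_mem /= gab /fL[[_ /gab]|].
Qed.

End SteinbergElements.

(** * Convolution with characteristic functions of cylinders *)

Section Convolution.
Variables (E : digraph) (S : comNzSemiRingType).
Local Notation G := (graph_groupoid E).
Local Notation A := (@steinberg G S).
Local Notation char := (@char_fun G S).
Local Notation conv := (@convolution G S).
Implicit Types (a b c d : prepath E) (s t : seq (edge E)) (x y z : gpath E).
Implicit Types (g h : graph_arrow E) (p q : graph_arrow E * graph_arrow E).
Implicit Types (f k : graph_arrow E -> S) (U V : set (graph_arrow E)).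

Definition composes p h :=
  ga_src p.1 = ga_rng p.2 /\
  arrow_val h = (ga_rng p.1, ga_lag p.1 + ga_lag p.2, ga_src p.2).

Lemma composes_rng p h : composes p h -> ga_rng h = ga_rng p.1.
Proof. by case=> _; rewrite /ga_rng => ->. Qed.

Lemma composes_src p h : composes p h -> ga_src h = ga_src p.2.
Proof. by case=> _; rewrite /ga_src => ->. Qed.

Lemma composes_lag p h : composes p h -> ga_lag h = ga_lag p.1 + ga_lag p.2.
Proof. by case=> _; rewrite /ga_lag => ->. Qed.

Lemma convolutionE f k h :
  conv f k h = \sum_(p \in [set p | composes p h]) f p.1 * k p.2.
Proof.
apply: eq_fsbigl; apply/seteqP; split=> -[g1 g2] /= [e1].
  by move=> <-; split=> //; exact: ga_composable.
move=> hE; have e : gsrc (g0 := G) g1 = grng (g0 := G) g2.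
  by apply: arrow_inj; rewrite /= e1.
by exists e; apply: arrow_inj; rewrite hE.
Qed.

Lemma composes_injl g h h' r : composes (g, h) r -> composes (g, h') r -> h = h'.
Proof.
move=> c1 c2; have [e1 _] := c1; have [e2 _] := c2; apply: arrow_eq.
- by rewrite -e1 -e2.
- by apply: (@addrI _ (ga_lag g)); rewrite -(composes_lag c1) -(composes_lag c2).
- by rewrite -(composes_src c1) -(composes_src c2).
Qed.

Lemma composes_injr g g' h r : composes (g, h) r -> composes (g', h) r -> g = g'.
Proof.
move=> c1 c2; have [e1 _] := c1; have [e2 _] := c2; apply: arrow_eq.
- by rewrite -(composes_rng c1) -(composes_rng c2).
- by apply: (@addIr _ (ga_lag h)); rewrite -(composes_lag c1) -(composes_lag c2).
- by rewrite e1 e2.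
Qed.

Lemma composes_divl g r : ga_rng g = ga_rng r -> exists h, composes (g, h) r.
Proof.
move=> gr; exists (GraphArrow (@mul_subproof _ (ga_inv g) r gr)).
split=> //=; rewrite gr /ga_rng /ga_lag /ga_src /=.
by rewrite addrA subrr add0r; case: (arrow_val r) => [[]].
Qed.

Lemma convolution_single f k p h : composes p h ->
  (forall q, composes q h -> q <> p -> f q.1 * k q.2 = 0) ->
  conv f k h = f p.1 * k p.2.
Proof.
move=> ph H; rewrite convolutionE -(fsbig_widen [set p]) ?fsbig_set1//.
  by move=> _ ->.
by move=> q [qh qp]; apply: H.
Qed.

Lemma convolution_neq0 f k h : conv f k h <> 0 ->
  exists p, [/\ composes p h, f p.1 <> 0 & k p.2 <> 0].
Proof.
move=> nz; apply: contrapT => np; apply: nz.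
rewrite convolutionE; apply: fsbig1 => p ph.
have [->|/eqP f0] := eqVneq (f p.1) 0; first by rewrite mul0r.
have [->|/eqP k0] := eqVneq (k p.2) 0; first by rewrite mulr0.
by case: np; exists p.
Qed.

Lemma char_neq0 U g : char U g <> 0 -> U g.
Proof. by rewrite char_funE; case: ifP => // /set_mem. Qed.

Lemma Zset_rng_inj a b g h : bipath a b -> Zset a b g -> Zset a b h ->
  ga_rng g = ga_rng h -> g = h.
Proof.
move=> ab gZ hZ e; apply: (ga_unit_rng_inj ab); rewrite ?inE//.
by apply: arrow_inj; rewrite /= e.
Qed.

Lemma Zset_src_inj a b g h : bipath a b -> Zset a b g -> Zset a b h ->
  ga_src g = ga_src h -> g = h.
Proof.
move=> ab gZ hZ e; apply: (ga_unit_src_inj ab); rewrite ?inE//.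
by apply: arrow_inj; rewrite /= e.
Qed.

(** A cylinder contains at most one arrow with a given range, so that only one
    factorization of [r] contributes. *)
Lemma convolution_charl a b f g h r : bipath a b -> Zset a b g ->
  composes (g, h) r -> conv (char (Zset a b)) f r = f h.
Proof.
move=> ab gZ ghr; rewrite (convolution_single ghr) => [/=|[g' h'] ghr' ne].
  by rewrite char_funE mem_set// mul1r.
rewrite /= char_funE; case: ifP => [/set_mem g'Z|]; last by rewrite mul0r.
case: ne; have gg' : g' = g.
  by apply: (Zset_rng_inj ab) => //; rewrite -(composes_rng ghr) -(composes_rng ghr').
by subst g'; rewrite (composes_injl ghr ghr').
Qed.

Lemma convolution_charr a b f g h r : bipath a b -> Zset a b h ->
  composes (g, h) r -> conv f (char (Zset a b)) r = f g.
Proof.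
move=> ab hZ ghr; rewrite (convolution_single ghr) => [/=|[g' h'] ghr' ne].
  by rewrite char_funE mem_set// mulr1.
rewrite /= char_funE; case: ifP => [/set_mem h'Z|]; last by rewrite mulr0.
case: ne; have hh' : h' = h.
  by apply: (Zset_src_inj ab) => //; rewrite -(composes_src ghr) -(composes_src ghr').
by subst h'; rewrite (composes_injr ghr ghr').
Qed.

Lemma convolution_charl0 a b f r : (forall y, is_boundary y ->
    gpath_src y = prng a -> ga_rng r <> pcat a y) ->
  conv (char (Zset a b)) f r = 0.
Proof.
move=> nr; apply: contrapT => /convolution_neq0[[g h] [ghr + _]].
move=> /char_neq0[y [bY ya gE]]; apply: (nr y) => //.
by rewrite (composes_rng ghr) /ga_rng gE.
Qed.

Lemma lag_ext_Zset a b s x g : bipath a b -> walk (prng a) s ->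
  is_boundary x -> gpath_src x = prng (pext a s) ->
  arrow_val g = lag_triple (pext a s) (pext b s) x -> Zset a b g.
Proof.
by move=> ab ws bx xs gE; apply: (Zset_pext_sub ab ws); exists x.
Qed.

Lemma composes_lag_triple a b c x g h r : arrow_val g = lag_triple a b x ->
  arrow_val h = lag_triple b c x -> arrow_val r = lag_triple a c x ->
  composes (g, h) r.
Proof.
rewrite /composes /ga_src /ga_rng /ga_lag /= => -> -> -> /=; split=> //.
by rewrite /lag_triple; congr (_, _, _); lia.
Qed.

(** Left multiplication by a cylinder exchanges the prefix [b] for [a]. *)
Lemma convolution_charl_lag a b d s x f h r : bipath a b -> walk (prng a) s ->
  is_boundary x -> gpath_src x = prng (pext a s) ->
  arrow_val r = lag_triple (pext a s) d x ->
  arrow_val h = lag_triple (pext b s) d x ->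
  conv (char (Zset a b)) f r = f h.
Proof.
move=> ab ws bx xs rE hE.
have [g gE] := arrow_exists (bipath_pext ab ws) bx xs.
apply: (convolution_charl _ ab (lag_ext_Zset ab ws bx xs gE)).
exact: composes_lag_triple gE hE rE.
Qed.

Lemma pcat_comparable a c x y : is_path a -> is_path c ->
  prng a = gpath_src x -> prng c = gpath_src y -> pcat a x = pcat c y ->
  exists s, (c = pext a s /\ x = pcat (prng a, s) y /\ walk (prng a) s) \/
            (a = pext c s /\ y = pcat (prng c, s) x /\ walk (prng c) s).
Proof.
move=> pa pc ax cy e; have [le|/ltnW le] := leqP (plen a) (plen c).
  by have [s [? ? ?]] := pcat_split pa pc ax cy le e; exists s; left.
by have [s [? ? ?]] := pcat_split pc pa cy ax le (esym e); exists s; right.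
Qed.

(** A presentation of [r] can be refined until its first component extends a
    given initial segment [a] of its range. *)
Lemma arrow_lag_prefix a y r : is_path a -> is_boundary y ->
  gpath_src y = prng a -> ga_rng r = pcat a y ->
  exists s d x, [/\ walk (prng a) s, bipath (pext a s) d, is_boundary x,
    gpath_src x = prng (pext a s) & arrow_val r = lag_triple (pext a s) d x].
Proof.
move=> pa bY ya; have [c [d [x [cd bx xc rE]]]] := arrow_lagP r.
rewrite /ga_rng rE /= => e; have [pc _ _] := cd.
have [s [[cE [yE ws]]|[aE [xE ws]]]] :=
  pcat_comparable pa pc (esym ya) (esym xc) (esym e).
  by exists s, d, x; rewrite -cE.
exists [::], (pext d s), y; rewrite pext_nil; split=> //.
  by rewrite aE; apply: bipath_pext.
by rewrite aE (lag_triple_pext _ _ (prng c)) -xE.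
Qed.

(** Exchanging prefixes carries basic sets to basic sets, which gives local
    constancy.  A cylinder [Zset c d] of the covering of [f] is turned into a
    cylinder after lengthening either [a] or [d], according to which of [b] and
    [c] extends the other. *)
Lemma convolution_charl_steinberg a b f : bipath a b -> A f ->
  A (conv (char (Zset a b)) f).
Proof.
move=> ab /steinberg_locally_constant[cf [L fL]]; have [pa pb eab] := ab.
apply: locally_constant_steinberg => [r|].
  have [[y [bY ya ry]]|nr] := pselect (exists y, [/\ is_boundary y,
      gpath_src y = prng a & ga_rng r = pcat a y]); last first.
    have nrZ : (~` Zset a a) (ga_unit_rng r).
      by move=> [y [bY ya]] [ry _ _]; apply: nr; exists y.
    have oZ : open (~` Zset a a).
      by apply: closed_openC; apply: Zset_closed; exact: bipathxx.
    have rZ : nbhs r (@ga_unit_rng E @^-1` ~` Zset a a).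
      exact: ga_unit_rng_continuous (open_nbhs_nbhs (conj oZ nrZ)).
    apply: filterS rZ => h hZ /=.
    rewrite (@convolution_charl0 _ _ _ r); last first.
      by move=> y bY ya ry; apply: nr; exists y.
    apply: convolution_charl0 => y bY ya hy; apply: hZ; exists y; split=> //.
    by rewrite /= hy /lag_triple subrr.
  have [s [d [x [ws asd bx xs rE]]]] := arrow_lag_prefix pa bY ya ry.
  have [_ pd ead] := asd.
  have eabs : prng (pext b s) = prng (pext a s) by rewrite !prng_pext eab.
  have bsd : bipath (pext b s) d.
    by split; rewrite ?eabs// is_path_pext pb -eab.
  have xs' : gpath_src x = prng (pext b s) by rewrite eabs.
  have [h hE] := arrow_exists bsd bx xs'.
  case: (nbhs_arrow bsd bx xs' hE (cf h)).
  move=> t [w [F [wt xE bw ws' [finF Ft wF tN]]]].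
  have eabt : prng (pext (pext b s) t) = prng (pext (pext a s) t).
    by rewrite prng_pext eabs -prng_pext.
  rewrite eabs in wt xE; rewrite eabt in Ft ws'.
  have rE' : arrow_val r = lag_triple (pext (pext a s) t) (pext d t) w.
    by rewrite (lag_triple_pext _ _ (prng (pext a s))) -xE.
  have asdt := bipath_pext asd wt.
  apply: filterS (nbhs_ZsetF asdt finF Ft bw ws' wF rE').
  move=> r' r'F /=; have [w' [bw' w't r'E]] := ZsetF_lag r'F.
  rewrite (convolution_charl_lag f ab ws bx xs rE hE).
  have bsdt : bipath (pext (pext b s) t) (pext d t).
    by apply: bipath_pext; rewrite ?eabs.
  have w't' : gpath_src w' = prng (pext (pext b s) t) by rewrite eabt.
  have [h' h'E] := arrow_exists bsdt bw' w't'.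
  have wst : walk (prng a) (s ++ t) by rewrite walk_cat ws -prng_pext.
  rewrite -pext_cat in r'E w't; rewrite -pext_cat in h'E.
  rewrite (convolution_charl_lag f ab wst bw' w't r'E h'E).
  apply: tN; rewrite pext_cat in h'E.
  have Ft' : F `<=` out_edges (prng (pext (pext b s) t)) by rewrite eabt.
  apply/(ZsetFE bsdt Ft' bw' w't' h'E).
  by rewrite pext_cat in r'E w't; apply/(ZsetFE asdt Ft bw' w't r'E).
(* Only one of the two entries is meaningful for a given pair; the other is
   harmless, as the list only has to cover the support. *)
exists (flatten [seq [:: (pext a (drop (plen b) cd.1.2), cd.2);
                       (a, pext cd.2 (drop (plen cd.1) b.2))] | cd <- L]).
move=> r /convolution_neq0[[g h] [[/= egh rE] /char_neq0 gZ /fL]].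
move: gZ rE egh => [y [bY ya]]; rewrite /ga_src /ga_rng /ga_lag => -> /=.
elim: {f cf fL} L => //= -[c d] L IHL rE egh; case=> /= [[cd [z [bz zc hE]]]|hL]; last first.
  by do 2 right; apply: IHL.
have [pc pd ecd] := cd.
have yb : prng b = gpath_src y by rewrite -eab.
rewrite hE /= in egh rE.
have [s [[cE [yE ws]]|[bE [zE ws]]]] :=
    pcat_comparable pb pc yb (esym zc) egh.
  left; have -> : drop (plen b) c.2 = s by rewrite cE drop_size_cat.
  have abs : prng (pext a s) = prng c by rewrite cE !prng_pext eab.
  split=> /=.
    by split; rewrite ?is_path_pext ?pa ?eab// abs.
  exists z; split; rewrite ?abs// rE yE /lag_triple -pcat_pext.
  by congr (_, _, _); rewrite cE !plen_pext; lia.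
right; left; have -> : drop (plen c) b.2 = s by rewrite bE drop_size_cat.
have eds : prng a = prng (pext d s) by rewrite eab bE !prng_pext ecd.
split=> /=; first by split; rewrite // is_path_pext pd -ecd.
exists y; split=> //; rewrite rE zE /lag_triple (pcat_pext d (prng c)).
by congr (_, _, _); rewrite bE !plen_pext; lia.
Qed.

Lemma covered_swap L g : covered L (ga_inv g) ->
  covered [seq (ab.2, ab.1) | ab <- L] g.
Proof.
elim: L => //= -[a b] L IHL [[ab gZ]|/IHL]; last by right.
left; split; first exact: bipath_sym.
by rewrite -[g]ga_invK; apply: ga_inv_Zset => //; case: ab.
Qed.

Lemma steinberg_inv f : A f -> A (f \o @ga_inv E).
Proof.
move=> /steinberg_locally_constant[cf [L fL]].
apply: locally_constant_steinberg.
  by move=> g; exact: ga_inv_continuous (cf (ga_inv g)).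
by exists [seq (ab.2, ab.1) | ab <- L] => g /fL/covered_swap.
Qed.

Lemma composes_inv p h :
  composes p h -> composes (ga_inv p.2, ga_inv p.1) (ga_inv h).
Proof.
move=> ph; have [e _] := ph; split; first exact: esym.
by rewrite /= (composes_rng ph) (composes_src ph) (composes_lag ph) opprD addrC.
Qed.

(** Inversion of arrows is an anti-automorphism, which turns statements about
    left multiplication into statements about right multiplication. *)
Lemma convolution_inv f k :
  conv f k \o @ga_inv E = conv (k \o @ga_inv E) (f \o @ga_inv E).
Proof.
apply/funext => h; rewrite /= !convolutionE.
rewrite (reindex_fsbig (fun p => (ga_inv p.2, ga_inv p.1)) [set p | composes p h]).
  by apply: eq_fsbigr => p _ /=; rewrite mulrC.
split=> [p /composes_inv //|p q _ _ e|].
  move: (congr1 fst e) (congr1 snd e) => /=.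
  move=> /(can_inj (@ga_invK E)) e2 /(can_inj (@ga_invK E)) e1.
  by case: p q e1 e2 {e} => [? ?] [? ?] /= -> ->.
move=> q /composes_inv; rewrite ga_invK => qh.
by exists (ga_inv q.2, ga_inv q.1) => //=; rewrite !ga_invK; case: q {qh}.
Qed.

Lemma char_Zset_inv a b : prng a = prng b ->
  char (Zset a b) \o @ga_inv E = char (Zset b a).
Proof.
move=> ab; apply/funext => g; rewrite /= !char_funE.
congr (if _ then _ else _); apply/idP/idP => /set_mem gZ; apply: mem_set.
  by rewrite -[g]ga_invK; apply: ga_inv_Zset.
by apply: ga_inv_Zset.
Qed.

Lemma convolution_charr_steinberg a b f : bipath a b -> A f ->
  A (conv f (char (Zset a b))).
Proof.
move=> ab Af; have [_ _ eab] := ab.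
have -> : conv f (char (Zset a b)) =
    conv (char (Zset b a)) (f \o @ga_inv E) \o @ga_inv E.
  rewrite convolution_inv char_Zset_inv//; congr conv.
  by apply/funext => g /=; rewrite ga_invK.
apply: steinberg_inv; apply: convolution_charl_steinberg.
  exact: bipath_sym.
exact: steinberg_inv.
Qed.

End Convolution.

(** * Congruence-simple commutative semirings *)

Section CongruenceSimpleSemirings.
Variable S : comNzSemiRingType.
Implicit Types (sigma : S -> S -> Prop) (x y z : S).

Definition semiring_congruence sigma :=
  [/\ forall x, sigma x x, forall x y, sigma x y -> sigma y x,
      forall x y z, sigma x y -> sigma y z -> sigma x z
    & forall x y z, sigma x y -> sigma (z + x) (z + y) /\ sigma (z * x) (z * y)].

Definition semiring_simple := forall sigma, semiring_congruence sigma ->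
  (forall x y, sigma x y -> x = y) \/ (forall x y, sigma x y).

(** Four congruences decide the structure of [S].  Having the same product
    with [a] shows that nonzero elements are cancellable; being archimedean
    equivalent, that [S] is either a ring or additively idempotent; being
    congruent modulo an ideal, that nonzero elements of a ring are invertible;
    and being both zero or both nonzero, that an idempotent [S] has only two
    elements. *)
Lemma simple_field_or_boolean : semiring_simple ->
  is_field S \/ is_boolean_semifield S.
Proof.
move=> simple.
have cancel a x y : a <> 0 -> a * x = a * y -> x = y.
  move=> a0; move: x y.
  have [|//|/(_ 1 0)] := simple (fun x y => a * x = a * y).
    split=> [//|x y -> //|x y z -> //|x y z e].
    by rewrite !mulrDr e !(mulrCA a) e.
  by rewrite mulr1 mulr0.
have [archi|archi] : (forall x, x + x = x) \/ (exists u, 1 + u = 0 :> S).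
(* The archimedean preorder: [y] is below a positive multiple of [x]. *)
- pose le x y := exists n u, x *+ n.+1 = y + u.
  have lexx x : le x x by exists 0%N, 0; rewrite addr0.
  have le_trans x y z : le x y -> le y z -> le x z.
    move=> [n [u xE]] [n' [u' yE]]; exists (n' + n * n'.+1)%N, (u' + u *+ n'.+1).
    rewrite (_ : (n' + n * n'.+1).+1 = n.+1 * n'.+1)%N; last by lia.
    by rewrite mulrnA xE mulrnDl yE addrA.
  have leD x y z : le x y -> le (z + x) (z + y).
    move=> [n [u xE]]; exists n, (u + z *+ n).
    rewrite mulrnDl xE mulrS -!addrA; congr (_ + _).
    by rewrite addrC -addrA.
  have leM x y z : le x y -> le (z * x) (z * y).
    by move=> [n [u xE]]; exists n, (z * u); rewrite -mulrDr -xE mulrnAr.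
  have [|idem|univ] := simple (fun x y => le x y /\ le y x).
  + split=> [//|x y [] //|x y z [xy yx] [yz zy]|x y z [xy yx]].
      by split; [exact: le_trans yz|exact: le_trans yx].
    by split; split; by [exact: leD|exact: leM].
  + left=> x; apply/esym/idem; split.
      by exists 1%N, 0; rewrite addr0.
    by exists 0%N, x.
  + by right; have [[n [u]]] := univ 0 1; rewrite mul0rn => /esym; exists u.
- right; pose nz x := x != 0.
  have addr_eq0 x y : x + y = 0 -> x = 0.
    by move=> xy; rewrite -[x]addr0 -xy addrA archi xy.
  have nz_eq w : nz w -> w = 1.
    have [|triv|univ] := simple (fun x y => nz x = nz y).
    + split=> [//|//|x y z -> //|x y z e]; split.
        have nzD u v : nz (u + v) = nz u || nz v.
          rewrite /nz -negb_and; congr negb; apply/eqP/andP => [uw|[]].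
            split; apply/eqP; first exact: addr_eq0 uw.
            by apply: (@addr_eq0 _ u); rewrite addrC.
          by move=> /eqP -> /eqP ->; rewrite addr0.
        by rewrite !nzD e.
      have [->|z0] := eqVneq z 0; first by rewrite !mul0r.
      have nzM u : nz (z * u) = nz u.
        rewrite /nz; congr negb; apply/eqP/eqP => [zu|->]; last exact: mulr0.
        by apply: (cancel z); rewrite ?mulr0//; exact/eqP.
      by rewrite !nzM.
    + by move=> nx; apply: triv; rewrite nx /nz oner_eq0.
    + by have := univ 1 0; rewrite /nz eqxx oner_eq0.
  exists nz; have nz0 : nz 0 = false by rewrite /nz eqxx.
  have nz1 : nz 1 = true by rewrite /nz oner_eq0.
  split.
    exists (fun b : bool => if b then 1 else 0) => [x|[]] //.
    by case: ifP => [/nz_eq ->|/negbT/negPn/eqP ->].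
  have cases x : x = 0 \/ x = 1.
    by have [->|/nz_eq ->] := eqVneq x 0; [left|right].
  split=> //.
    move=> x y; have [->|->] := cases x; have [->|->] := cases y;
      by rewrite ?addr0 ?add0r ?archi ?nz0 ?nz1.
  by move=> x y; have [->|->] := cases x; have [->|->] := cases y;
    rewrite ?mulr0 ?mulr1 ?nz0 ?nz1.
(* [n] is minus one, so [x * n] is the opposite of [x]. *)
left; have [n nE] := archi.
have addV x : x + x * n = 0 by rewrite -{1}[x]mulr1 -mulrDr nE mulr0.
split=> [x|a a0]; first by exists (x * n).
have [|triv|univ] :=
    simple (fun x y => exists u w, x + a * u = y + a * w).
- split=> [x|x y [u [w e]]|x y z [u [w e]] [u' [w' e']]|x y z [u [w e]]].
  + by exists 0, 0.
  + by exists w, u.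
  + exists (u + u'), (w + w'); rewrite !mulrDr !addrA e [LHS]addrAC e'.
    by rewrite addrAC.
  + split; first by exists u, w; rewrite -!addrA e.
    by exists (z * u), (z * w); rewrite !(mulrCA a) -!mulrDr e.
- by case: a0; apply/esym/triv; exists 1, 0; rewrite mulr0 addr0 add0r mulr1.
have [u [w e]] := univ 1 0; exists (w + u * n).
by rewrite mulrDr mulrA -[a * w]add0r -e -addrA addV addr0.
Qed.

End CongruenceSimpleSemirings.

(** * Boundary paths *)

Section BoundaryPaths.
Variable E : digraph.
Implicit Types (a b c : prepath E) (s t : seq (edge E)) (x y z : gpath E).
Implicit Types (H : set (vertex E)) (v : vertex E).

(** No vertex on the boundary path [x] lies in [H]. *)
Definition avoids H x := forall a y, is_path a -> is_boundary y ->
  prng a = gpath_src y -> x = pcat a y -> ~ H (gpath_src y).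

Lemma hereditary_walk H v s : hereditary H -> H v -> walk v s ->
  H (last v (map etgt s)).
Proof.
move=> hH; elim: s v => //= e s IHs v Hv /andP[/eqP ev ws].
by apply: IHs => //; apply: hH; rewrite ev.
Qed.

Lemma avoids_pcat H a x : hereditary H -> is_path a -> is_boundary x ->
  prng a = gpath_src x -> avoids H (pcat a x) <-> avoids H x.
Proof.
move=> hH pa bx ax; split=> [Hax b y pb bY yb xE|Hx b y pb bY yb xE].
  have wb : walk (prng a) b.2 by rewrite ax xE gpath_src_pcat.
  apply: (Hax (pext a b.2) y) => //; first by rewrite is_path_pext pa.
    rewrite prng_pext -yb; congr (last _ _).
    by rewrite ax xE gpath_src_pcat.
  rewrite (pcat_pext a (prng a)) xE; congr (pcat a (pcat _ y)).
  by rewrite ax xE gpath_src_pcat//; case: (b).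
have [s [[bE [xE' ws]]|[aE [yE ws]]]] := pcat_comparable pa pb ax yb xE.
  by apply: (Hx (prng a, s) y) => //; rewrite -yb bE prng_pext.
move=> Hy; apply: (Hx (vpath (gpath_src x)) x) => //.
  by rewrite pcat_nil.
rewrite -ax aE prng_pext; apply: hereditary_walk => //.
by rewrite yb.
Qed.

(** Outside a saturated set one can walk forever, or until a vertex that is not
    regular, without entering the set. *)
Lemma boundary_avoiding H v : hereditary H -> saturated H -> ~ H v ->
  exists x, [/\ is_boundary x, gpath_src x = v & avoids H x].
Proof.
move=> hH sH nHv.
pose P s := walk v s /\ ~ H (last v (map etgt s)).
have [PS|/existsNP[s /not_implyP[[ws ns] noe]]] :=
    pselect (forall s, P s -> exists e, P (rcons s e)).
  have [f Pf] := @dependent_choice_seq _ P (conj isT nHv) PS.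
  have [bf fv] := @walk_mkseq_boundary _ v f (fun n => (Pf n).1).
  exists (InfPath f); split=> // b [//|k] pb bk bE [fE].
  have -> : gpath_src (InfPath k) = esrc (f (plen b)).
    by rewrite fE nth_default// subnn.
  by rewrite -(last_mkseq (Pf (plen b).+1).1); exact: (Pf _).2.
exists (FinPath (v, s)); split=> //.
  split=> //; apply: contrapT => /not_orP[nsink /contrapT fin].
  apply: ns; apply: sH.
    by split=> //; apply/set0P/negP => /eqP.
  move=> _ [e ep <-]; apply: contrapT => nHe; apply: noe; exists e.
  by rewrite /P -cats1 walk_cat map_cat last_cat ws /= ep eqxx.
move=> b [[w t]|//] pb [wt _] bw [vb sE] Hw; apply: ns.
rewrite sE map_cat last_cat vb -[last b.1 _]/(prng b) bw.
exact: hereditary_walk.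
Qed.

Lemma boundary_exists v : exists x, is_boundary x /\ gpath_src x = v.
Proof.
have [||//|x [bx xv _]] := @boundary_avoiding set0 v; last by exists x.
  by [].
by move=> u [[e ue] _] /(_ (etgt e)); apply; exists e.
Qed.

(** Each vertex of a cycle without exit emits exactly one edge, and this edge
    leads to the next vertex of the cycle; hence the continuation is forced, and
    it never stops. *)
Lemma cycle_no_exit_boundary c x y : is_cycle c -> ~ has_exit c ->
  is_boundary x -> is_boundary y -> gpath_src x = psrc c ->
  gpath_src y = psrc c -> x = y.
Proof.
move=> [pc lc cc uc] nexit.
pose W u := u \in map esrc c.2.
have det e e' : W (esrc e) -> esrc e' = esrc e -> e' = e.
  move=> /mapP[e0 ce0 ee0] e'e; suff H k : esrc k = esrc e0 -> k = e0.
    by rewrite (H e)// (H e')// e'e.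
  by move=> ke0; apply: contrapT => ne; apply: nexit; exists k, e0; split.
have inW e : W (esrc e) -> e \in c.2.
  by move=> We; have /mapP[e0 ce0 ee0] := We; rewrite (det e0 e) -?ee0.
have W0 : W (psrc c).
  move: lc pc; rewrite /W /psrc /is_path /plen.
  by case: (c) => u [//|e s] /= _ /andP[/eqP -> _]; exact: mem_head.
have Wtgt e : W (esrc e) -> W (etgt e).
  move=> /inW ce; have [s1 [s2 cE]] : exists s1 s2, c.2 = s1 ++ e :: s2.
    by case/path.splitPr: ce => s1 s2; exists s1, s2.
  move: pc cc; rewrite /is_path /prng cE walk_cat map_cat last_cat /=.
  case: s2 cE => [_ _ /= <- //|e' s2 cE /= /and4P[_ _ /eqP <- _] _].
  by rewrite /W cE map_cat mem_cat /= !inE eqxx !orbT.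
have Wlast u s : W u -> walk u s -> W (last u (map etgt s)).
  elim: s u => //= e s IHs u Wu /andP[/eqP eu ws].
  by apply: IHs => //; apply: Wtgt; rewrite eu.
have inf z : is_boundary z -> gpath_src z = psrc c -> exists f, z = InfPath f.
  case: z => [[v s] [ws r] vc|f]; last by exists f.
  have /mapP[e ce ve] : W (prng (v, s)).
    by apply: Wlast => //; rewrite -[v]/(gpath_src (FinPath (v, s))) vc.
  case: r => [sink|inf].
    by suff : out_edges (prng (v, s)) e by rewrite sink.
  case: inf; apply: (@sub_finite_set _ _ [set e]) => // e' e'v.
  by apply: det; rewrite -?ve //; apply/mapP; exists e.
move=> bx bY xc yc; have [f xE] := inf x bx xc; have [k yE] := inf y bY yc.
subst x y; congr InfPath; apply/funext => i.
suff [fk Wf] : f i = k i /\ W (esrc (f i)) by [].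
elim: i => [|i [fk Wf]].
  have fk : f 0%N = k 0%N.
    by apply: det; [rewrite -[esrc _]/(gpath_src (InfPath k)) yc|exact: etrans (esym yc)].
  by split=> //; rewrite -[esrc _]/(gpath_src (InfPath f)) xc.
have Wf' : W (esrc (f i.+1)) by rewrite -(bx i); exact: Wtgt.
by split=> //; apply/esym/det => //; rewrite -(bY i) -(bx i) fk.
Qed.

End BoundaryPaths.

(** * Row sums and the action on functions of boundary paths *)

Lemma fsum_distrr (S : comNzSemiRingType) (I : choiceType) (P : set I) (c : S)
  (F : I -> S) : finite_set P ->
  c * (\sum_(i \in P) F i) = \sum_(i \in P) c * F i.
Proof. by move=> finP; rewrite !fsbig_finite// big_distrr. Qed.

Section RowSums.
Variables (E : digraph) (S : comNzSemiRingType).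
Local Notation G := (graph_groupoid E).
Local Notation A := (@steinberg G S).
Local Notation char := (@char_fun G S).
Local Notation conv := (@convolution G S).
Implicit Types (a b c d : prepath E) (x y z : gpath E).
Implicit Types (g h r : graph_arrow E).
Implicit Types (f k : graph_arrow E -> S) (m : gpath E -> S).

Definition row x f : set (graph_arrow E) := [set g | ga_rng g = x /\ f g <> 0].

(** A cylinder contains at most one arrow with a given range. *)
Lemma row_finite x f : A f -> finite_set (row x f).
Proof.
move=> /steinberg_locally_constant[_ [L fL]].
apply: (@sub_finite_set _ _ [set g | ga_rng g = x /\ covered L g]).
  by move=> g [gx /fL].
elim: L {f fL} => [|[a b] L IHL]; first by apply: sub_finite_set (finite_set0 _) => g [].
have [[g0 [g0x [ab g0Z]]]|none] := pselect (exists g,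
    ga_rng g = x /\ bipath a b /\ Zset a b g).
  apply: (@sub_finite_set _ _ ([set g0] `|` [set g | ga_rng g = x /\ covered L g])).
    move=> g [gx [[_ gZ]|gL]]; last by right.
    by left; apply: (Zset_rng_inj ab); rewrite // gx.
  by rewrite finite_setU; split.
apply: sub_finite_set IHL => g [gx [gZ|gL]] //.
by case: none; exists g.
Qed.

Lemma ldiv_subproof g r : exists h, ga_rng g = ga_rng r -> composes (g, h) r.
Proof.
have [/composes_divl[h gh]|ne] := pselect (ga_rng g = ga_rng r); first by exists h.
by exists g.
Qed.

(** The quotient of [r] by [g] on the left, when the two have the same range. *)
Definition ldiv g r := projT1 (cid (ldiv_subproof g r)).

Lemma ldivP g r : ga_rng g = ga_rng r -> composes (g, ldiv g r) r.
Proof. exact: (projT2 (cid (ldiv_subproof g r))). Qed.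

Lemma composes_mulr g h : ga_src g = ga_rng h -> exists r, composes (g, h) r.
Proof. by move=> gh; exists (GraphArrow (mul_subproof gh)). Qed.

Lemma convolution_row f k r :
  conv f k r = \sum_(g \in row (ga_rng r) f) f g * k (ldiv g r).
Proof.
have -> : \sum_(g \in row (ga_rng r) f) f g * k (ldiv g r) =
    \sum_(g \in [set g | ga_rng g = ga_rng r]) f g * k (ldiv g r).
  apply: fsbig_widen => [g []//|g /= [gr nfg]].
  have [->|/eqP fg] := eqVneq (f g) 0; first by rewrite mul0r.
  by case: nfg.
rewrite convolutionE (reindex_fsbig (fun g => (g, ldiv g r))
  [set g | ga_rng g = ga_rng r]) //; split.
- by move=> g /= /ldivP.
- by move=> g h _ _ [].
- move=> [g h] /= ghr; have gr : ga_rng g = ga_rng r by rewrite (composes_rng ghr).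
  by exists g => //; rewrite (composes_injl (ldivP gr) ghr).
Qed.

(** The action of the algebra on functions on the boundary path space, where an
    arrow from [y] to [x] carries the value at [y] to [x]. *)
Definition act f m x := \sum_(g \in [set g | ga_rng g = x]) f g * m (ga_src g).

Lemma act_row f m x : act f m x = \sum_(g \in row x f) f g * m (ga_src g).
Proof.
apply/esym/fsbig_widen => [g []//|g /= [gr nfg]].
have [->|/eqP fg] := eqVneq (f g) 0; first by rewrite mul0r.
by case: nfg.
Qed.

Lemma actD f k m x : A f -> A k -> act (f + k) m x = act f m x + act k m x.
Proof.
move=> Af Ak; pose R := row x f `|` row x k.
have finR : finite_set R by rewrite finite_setU; split; exact: row_finite.
have actR u : row x u `<=` R -> act u m x = \sum_(g \in R) u g * m (ga_src g).
  move=> uR; rewrite act_row; apply: fsbig_widen => // g [[] [gx _] nu] /=.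
    have [->|/eqP ug] := eqVneq (u g) 0; first by rewrite mul0r.
    by case: nu.
  have [->|/eqP ug] := eqVneq (u g) 0; first by rewrite mul0r.
  by case: nu.
rewrite !actR; [|by move=> g; right|by move=> g; left|].
  rewrite -fsbig_split//; apply: eq_fsbigr => g _.
  by rewrite addrfctE mulrDl.
move=> g [gx]; rewrite addrfctE => fkg.
have [fg|/eqP fg] := eqVneq (f g) 0; last by left.
by right; split=> // kg; apply: fkg; rewrite fg kg addr0.
Qed.

(** Both sides sum over composable pairs of arrows; the finite set [T] collects
    the composites that contribute, so that the sums can be exchanged. *)
Lemma act_convolution f k m x : A f -> A k ->
  act (conv f k) m x = act f (act k m) x.
Proof.
move=> Af Ak; pose R := row x f; have finR : finite_set R by exact: row_finite.
pose T := \bigcup_(g in R) [set r | ga_rng r = x /\ k (ldiv g r) <> 0].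
have finT : finite_set T.
  apply: bigcup_finite => // g [gx _].
  have /choice[mg mgP] : forall h, exists r, ga_src g = ga_rng h -> composes (g, h) r.
    move=> h; have [/composes_mulr[r]|] := pselect (ga_src g = ga_rng h).
      by exists r.
    by exists g.
  apply: (@sub_finite_set _ _ (mg @` row (ga_src g) k)).
    move=> r [rx kr]; have gr := ldivP (etrans gx (esym rx)).
    have [e _] := gr; exists (ldiv g r); first by split.
    apply: arrow_inj; have [_ ->] := mgP _ e; by have [_ ->] := gr.
  by apply: finite_image; exact: row_finite.
have -> : act (conv f k) m x = \sum_(r \in T) conv f k r * m (ga_src r).
  rewrite /act; apply/esym/fsbig_widen => [r [g _ []//]|r /= [rx nT]].
  rewrite convolution_row rx fsbig1 ?mul0r// => g gR.
  have [->|/eqP kr] := eqVneq (k (ldiv g r)) 0; first by rewrite mulr0.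
  by case: nT; exists g.
transitivity (\sum_(r \in T) \sum_(g \in R) f g * (k (ldiv g r) * m (ga_src r))).
  apply: eq_fsbigr => r /set_mem[g _ [rx _]].
  rewrite convolution_row rx mulrC fsum_distrr//.
  by apply: eq_fsbigr => h _ /=; rewrite mulrC mulrA.
rewrite exchange_fsbig// act_row; apply: eq_fsbigr => g /set_mem gR.
rewrite -fsum_distrr//.
congr (_ * _); have [gx _] := gR.
transitivity (\sum_(r \in [set r | ga_rng r = x]) k (ldiv g r) * m (ga_src r)).
  apply: fsbig_widen => [r [h _ []//]|r /= [rx nT]].
  have [->|/eqP kr] := eqVneq (k (ldiv g r)) 0; first by rewrite mul0r.
  by case: nT; exists g.
have gP r : ga_rng r = x -> composes (g, ldiv g r) r by move=> rx; apply: ldivP; rewrite rx.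
rewrite /act (reindex_fsbig (ldiv g) [set r | ga_rng r = x]
  [set h | ga_rng h = ga_src g]).
  by apply: eq_fsbigr => r /set_mem /gP gr; rewrite (composes_src gr).
split.
- by move=> r /= /gP [].
- move=> r r' /set_mem /gP gr /set_mem /gP gr' e; apply: arrow_inj.
  by have [_ ->] := gr; have [_ ->] := gr'; rewrite /= e.
- move=> h /= hg; have [r ghr] := composes_mulr (esym hg).
  have rx : ga_rng r = x by rewrite (composes_rng ghr).
  by exists r => //; rewrite (composes_injl (gP _ rx) ghr).
Qed.

(** The idempotent of the vertex [v]. *)
Definition vchar v := char (Zset (vpath v) (vpath v)).

Lemma vchar_steinberg v : A (vchar v).
Proof. exact: char_Zset_steinberg. Qed.

Lemma vchar1 v x g : is_boundary x -> gpath_src x = v ->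
  arrow_val g = lag_triple (vpath v) (vpath v) x -> vchar v g = 1.
Proof. by move=> bx xv gE; rewrite /vchar char_funE mem_set//; exists x. Qed.

Lemma unit_arrow v x : is_boundary x -> gpath_src x = v ->
  exists g, arrow_val g = lag_triple (vpath v) (vpath v) x /\ ga_rng g = x.
Proof.
move=> bx xv; have vv : bipath (vpath v) (vpath v) by [].
have [g gE] := arrow_exists vv bx xv; exists g; split=> //.
by rewrite /ga_rng gE /= -xv; exact: pcat_nil.
Qed.

Lemma act_char b v m x : bipath (vpath v) b -> is_boundary x ->
  gpath_src x = v -> act (char (Zset (vpath v) b)) m x = m (pcat b x).
Proof.
move=> vb bx xv; have [g gE] := arrow_exists vb bx xv.
have gZ : Zset (vpath v) b g by exists x.
have gx : ga_rng g = x by rewrite /ga_rng gE /= -xv; exact: pcat_nil.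
rewrite /act -(fsbig_widen [set g]) ?fsbig_set1.
- by rewrite char_funE mem_set// mul1r /ga_src gE.
- by move=> _ ->.
move=> h [/= hx hg]; rewrite char_funE; case: ifP => [/set_mem hZ|_]; last by rewrite mul0r.
by case: hg; apply: (Zset_rng_inj vb); rewrite // gx.
Qed.

Lemma act_char0 b v m x : ~ (is_boundary x /\ gpath_src x = v) ->
  act (char (Zset (vpath v) b)) m x = 0.
Proof.
move=> nx; rewrite /act fsbig1// => g /= gx; rewrite char_funE.
case: ifP => [/set_mem[y [bY yv gE]]|_]; last by rewrite mul0r.
case: nx; rewrite -gx /ga_rng gE /=.
have -> : vpath v = (gpath_src y, [::]) by rewrite yv.
by rewrite pcat_nil.
Qed.

End RowSums.

(** * Necessity of the three conditions *)

Section Necessity.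
Variables (E : digraph) (S : comNzSemiRingType) (v0 : vertex E).
Local Notation G := (graph_groupoid E).
Local Notation A := (@steinberg G S).
Local Notation char := (@char_fun G S).
Local Notation conv := (@convolution G S).
Local Notation vchar := (@vchar E S).
Implicit Types (f k : graph_arrow E -> S).
Hypothesis simple : congruence_simple conv A.

Lemma fsum_congruence (sigma : S -> S -> Prop) (I : choiceType) (P : set I)
  (F F' : I -> S) : semiring_congruence sigma -> finite_set P ->
  (forall i, P i -> sigma (F i) (F' i)) ->
  sigma (\sum_(i \in P) F i) (\sum_(i \in P) F' i).
Proof.
move=> [srefl _ strans scomp] finP FF'; rewrite !fsbig_finite// !big_seq.
elim/big_rec2: _ => // i y x; rewrite in_fset_set// => /set_mem /FF' Fi xy.
apply: (strans _ (F i + y)); first exact: (scomp _ _ _ xy).1.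
by have [+ _] := scomp _ _ y Fi; rewrite ![y + _]addrC.
Qed.

(** A congruence of [S], imposed at every arrow, is a congruence of the algebra:
    each value of a product is a finite sum. *)
Lemma coefficients_simple : semiring_simple S.
Proof.
move=> sigma scong; have [srefl ssym strans scomp] := scong.
have convl f k k' : A f -> (forall g, sigma (k g) (k' g)) ->
    forall g, sigma (conv f k g) (conv f k' g).
  move=> Af kk' g; rewrite !convolution_row; apply: fsum_congruence => //.
    exact: row_finite.
  by move=> h _; exact: (scomp _ _ _ (kk' _)).2.
have convr f k k' : A f -> (forall g, sigma (k g) (k' g)) ->
    forall g, sigma (conv k f g) (conv k' f g).
  move=> Af kk' g; rewrite -[g]ga_invK.
  rewrite -![conv _ _ (ga_inv _)]/((conv _ _ \o @ga_inv E) _) !convolution_inv.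
  by apply: (convl _ _ _ (steinberg_inv Af)) => h; exact: kk'.
have [x [bx xv]] := boundary_exists v0.
have [g [gE _]] := unit_arrow bx xv.
have Av := @vchar_steinberg E S v0; have [_ _ AZ] := subsemimodule_steinberg E S.
have vg c : c * vchar v0 g = c by rewrite (vchar1 S bx xv gE) mulr1.
have [|triv|univ] := simple.2 (fun f k => forall h, sigma (f h) (k h)).
- split=> [//|f k _ _ fk h|f k u _ _ _ fk ku h|f k u _ _ Au fk].
  + exact: ssym.
  + exact: strans (ku h).
  + by split; [move=> h; exact: (scomp _ _ _ (fk h)).1|exact: convl|exact: convr].
- left=> c d cd; have := triv _ _ (AZ c _ Av) (AZ d _ Av).
  move=> /(_ _)/(congr1 (fun f => f g)); rewrite !vg; apply=> h.
  by rewrite ![_ * vchar v0 h]mulrC; exact: (scomp _ _ _ cd).2.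
- by right=> c d; rewrite -(vg c) -(vg d); exact: (univ _ _ (AZ c _ Av) (AZ d _ Av)).
Qed.

(** The boundary paths that avoid [H] form an invariant set, so agreement on the
    arrows between them is a congruence.  It kills the idempotents of the
    vertices in [H], but not those of the vertices outside [H], as some boundary
    path from there avoids [H]. *)
Lemma hereditary_saturated_trivial (H : set (vertex E)) :
  hereditary H -> saturated H -> H = set0 \/ H = setT.
Proof.
move=> hH sH; have [H0|/set0P[v Hv]] := eqVneq H set0; [by left|right].
apply/seteqP; split=> // w _; apply: contrapT => nHw.
have avoid_src (g : graph_arrow E) : avoids H (ga_rng g) -> avoids H (ga_src g).
  have [a [b [x [[pa pb ab] bx xa gE]]]] := arrow_lagP g.
  rewrite /ga_rng /ga_src gE /= => /(avoids_pcat hH pa bx (esym xa)) Hx.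
  by apply/(avoids_pcat hH pb bx) => //; rewrite -ab.
have [|triv|univ] := simple.2 (fun f k =>
    forall g : graph_arrow E, avoids H (ga_rng g) -> f g = k g).
- split=> [//|f k _ _ fk g /fk //|f k u _ _ _ fk ku g gH|f k u _ _ _ fk].
    by rewrite fk// ku.
  split=> g gH; first by rewrite !addrfctE fk.
    rewrite !convolutionE; apply: eq_fsbigr => p /set_mem pg; congr (_ * _).
    apply: fk; have [<- _] := pg; apply: avoid_src.
    by rewrite -(composes_rng pg).
  rewrite !convolutionE; apply: eq_fsbigr => p /set_mem pg; congr (_ * _).
  by apply: fk; rewrite -(composes_rng pg).
- have [x [bx xv]] := boundary_exists v; have [g [gE _]] := unit_arrow bx xv.
  have A0 : A 0 by case: (subsemimodule_steinberg E S).
  have := triv _ _ (@vchar_steinberg E S v) A0.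
  move=> /(_ _)/(congr1 (fun f => f g)); rewrite (vchar1 S bx xv gE) => e.
  suff : (1 : S) = 0 by move=> /eqP; rewrite oner_eq0.
  apply: e => h havoid; rewrite /vchar char_funE; case: ifP => // /set_mem[y [bY yv hE]].
  case: (havoid (vpath v) y); rewrite ?yv//.
  by rewrite /ga_rng hE.
- have [x [bx xw wH]] := boundary_avoiding hH sH nHw.
  have [g [gE gx]] := unit_arrow bx xw.
  have A0 : A 0 by case: (subsemimodule_steinberg E S).
  have := univ _ _ (@vchar_steinberg E S w) A0 g.
  rewrite gx (vchar1 S bx xw gE) => /(_ wH) /eqP.
  by rewrite oner_eq0.
Qed.

(** Inducing the same operator on functions of boundary paths is a congruence.
    If the cycle [c] at [v] has no exit, only one boundary path leaves [v] and
    it is fixed by prefixing [c]; then the distinct functions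
    of the cylinders [(v, v)] and [(v, c)] induce the same operator. *)
Lemma cycle_has_exit (c : prepath E) : is_cycle c -> has_exit c.
Proof.
move=> cyc; apply: contrapT => nexit.
have [pc lc cc uc] := cyc; pose v := psrc c.
have vc : bipath (vpath v) c by [].
have vv : bipath (vpath v) (vpath v) by [].
have A0 : A 0 by case: (subsemimodule_steinberg E S).
have [x [bx xv]] := boundary_exists v; have [g [gE _]] := unit_arrow bx xv.
have [|triv|univ] := simple.2 (fun f k => forall m x, act f m x = act k m x).
- split=> [//|f k _ _ fk m y|f k u _ _ _ fk ku m y|f k u Af Ak Au fk].
  + by rewrite fk.
  + by rewrite fk.
  + by split=> m y; rewrite ?actD// ?act_convolution// ?fk//; congr act;
      apply/funext => z; rewrite fk.
- have := triv _ _ (@vchar_steinberg E S v) (@char_Zset_steinberg E S _ _ vc).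
  move=> /(_ _)/(congr1 (fun f => f g)); rewrite (vchar1 S bx xv gE) => e.
  have : (1 : S) = char (Zset (vpath v) c) g.
    apply: e => m y; have [[bY yv]|ny] := pselect (is_boundary y /\ gpath_src y = v).
      rewrite !act_char//; congr m.
      apply: (cycle_no_exit_boundary cyc nexit).
      + by apply: pcat_boundary => //; rewrite yv.
      + by apply: pcat_boundary => //; rewrite -cc yv.
      + by rewrite gpath_src_pcat.
      + by rewrite gpath_src_pcat// -cc yv.
    by rewrite !act_char0.
  rewrite char_funE; case: ifP => [/set_mem[y [bY yv]]|_ /eqP].
    (* The lag of the unit [g] is 0, that of an arrow of the cylinder is not. *)
    rewrite gE => /(congr1 (fun t => t.1.2)) /=.
    by rewrite subrr -[plen (vpath v)]/0%N sub0r; move: lc; case: (plen c).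
  by rewrite oner_eq0.
have := univ _ _ (@vchar_steinberg E S v) A0 (fun=> 1) x.
rewrite act_char// /act fsbig1 => [/eqP|h _]; first by rewrite oner_eq0.
by rewrite mul0r.
Qed.

End Necessity.

(** * Separating cylinders when every cycle has an exit *)

Section Aperiodicity.
Variable E : digraph.
Implicit Types (a b c p q : prepath E) (s t : seq (edge E)) (x y z w : gpath E).

(** A closed walk that visits some vertex twice contains a shorter closed walk. *)
Lemma closed_walk_cycle v s : walk v s -> s != [::] ->
  last v (map etgt s) = v :> vertex E ->
  exists c, is_cycle c /\ {subset c.2 <= s}.
Proof.
have [n] := ubnP (size s); elim: n => // n IHn in v s *.
rewrite ltnS => sn ws s0 sv; have [us|] := boolP (uniq (map esrc s)).
  by exists (v, s); split=> //; split=> //; case: (s) s0.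
case: s s0 => // e0 s' _ in sn ws sv *; set s := e0 :: s' in sn ws sv *.
move=> /(uniqPn (esrc e0))[i [j [ij]]]; rewrite size_map => js.
have is_ : (i < size s)%N by exact: ltn_trans js.
rewrite !(nth_map e0)// => eij.
pose t := take (j - i) (drop i s).
have szt : size t = (j - i)%N by rewrite size_takel// size_drop leq_sub2r// ltnW.
have dE : drop j s = drop (j - i) (drop i s) by rewrite drop_drop subnK// ltnW.
have sE : s = take i s ++ t ++ drop j s by rewrite dE /t !cat_take_drop.
have [u [wt tu]] : exists u, walk u t /\ last u (map etgt t) = u.
  exists (last v (map etgt (take i s))); move: ws; rewrite {1}sE !walk_cat.
  rewrite (drop_nth e0 js) /= => /and3P[_ wt /andP[/eqP <- _]]; split=> //.
  rewrite -eij; move: wt; rewrite /t (drop_nth e0 is_).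
  by move: ij; rewrite -subn_gt0; case: (j - i)%N => //= m _ /andP[/eqP].
have [||c [cyc ct]] := IHn u t _ wt _ tu.
- by rewrite szt; apply: leq_trans sn; apply: leq_ltn_trans js; exact: leq_subr.
- by rewrite -size_eq0 szt subn_eq0 -ltnNge.
exists c; split=> // e /ct et; rewrite sE !mem_cat et orbT; done.
Qed.

(** Some arrow of [Zset a b] joins two points of the cylinder of [q]; in other
    words, [Zset a b] survives the compression to this cylinder. *)
Definition meets q a b := exists y z w,
  [/\ is_boundary y /\ gpath_src y = prng a,
      is_boundary z /\ gpath_src z = prng q,
      is_boundary w /\ gpath_src w = prng q,
      pcat a y = pcat q z & pcat b y = pcat q w].

Lemma meets_pext q s a b : is_path q -> walk (prng q) s ->
  meets (pext q s) a b -> meets q a b.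
Proof.
move=> pq ws [y [z [w [yE [bz zq] [bw wq] az bw']]]].
have ps : is_path (prng q, s) by [].
have rs : prng (prng q, s) = prng (pext q s) by rewrite prng_pext.
exists y, (pcat (prng q, s) z), (pcat (prng q, s) w).
split; rewrite -?pcat_pext//; split;
  rewrite ?gpath_src_pcat ?rs//; by apply: pcat_boundary; rewrite ?rs.
Qed.

Lemma meets_sym q a b : prng a = prng b -> meets q a b -> meets q b a.
Proof. by move=> ab [y [z [w [[bY ya] ? ? ? ?]]]]; exists y, w, z; rewrite -ab. Qed.

Lemma sink_boundary u z : is_sink u -> is_boundary z -> gpath_src z = u ->
  z = FinPath (u, [::]).
Proof.
move=> sink; have none e : esrc e <> u by move=> eu; rewrite -[False]/(set0 e) -sink.
case: z => [[v [|e s]] [wz _]|f bf] zu //; first by rewrite -zu.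
  by case/andP: wz => /eqP ev _; case: (none e); rewrite ev.
by case: (none (f 0%N)).
Qed.

(** The cylinder of a path [q] that ends at a sink is one finite path; [a] and
    [b] are continued to it by the same tail, so they agree. *)
Lemma meets_sink q a b : meets q a b -> is_sink (prng q) -> a = b.
Proof.
move=> [y [z [w [yE [bz zq] [bw wq] az bw']]]] sink.
have e : pcat a y = pcat b y.
  by rewrite az bw' (sink_boundary sink bz zq) (sink_boundary sink bw wq).
case: y e az {bw' yE} => [[v s]|f] /= e; last first.
  by rewrite (sink_boundary sink bz zq).
move=> _; case: e => eab e.
have /eqP sab : size a.2 = size b.2.
  by have := congr1 size e; rewrite !size_cat => /addIn.
move/eqP: e; rewrite eqseq_cat; last exact/eqP.
by rewrite eqxx andbT => /eqP; case: a b eab {sab} => ? ? [? ?] /= -> ->.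
Qed.

(** At depth beyond [a] and [b], a point of the cylinder of [q] that is moved
    by [Zset a b] within this cylinder must repeat itself with the lag as
    period. *)
Lemma meets_periodic q a b e0 j : is_path q -> is_path a -> is_path b ->
  prng a = prng b -> meets q a b -> (plen a < plen b)%N -> (plen a <= j)%N ->
  (j + (plen b - plen a) < plen q)%N ->
  nth e0 q.2 j = nth e0 q.2 (j + (plen b - plen a)).
Proof.
move=> pq pa pb eab [y [z [w [[bY ya] [bz zq] [bw wq] az bw']]]] ab aj jq.
have laq : (plen a <= plen q)%N by lia.
have lbq : (plen b <= plen q)%N by lia.
have [t [qa wt yE]] := pcat_split pa pq (esym ya) (esym zq) laq az.
have yb : prng b = gpath_src y by rewrite -eab.
have [t' [qb wt' yE']] := pcat_split pb pq yb (esym wq) lbq bw'.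
have qaE : q.2 = a.2 ++ t by rewrite qa.
have qbE : q.2 = b.2 ++ t' by rewrite qb.
have st : plen q = (plen a + size t)%N by rewrite /plen qaE size_cat.
have st' : plen q = (plen b + size t')%N by rewrite /plen qbE size_cat.
rewrite {1}qaE qbE !nth_cat -/(plen a) -/(plen b).
rewrite !ifN -?leqNgt; [|lia|lia].
have -> : (j + (plen b - plen a) - plen b = j - plen a)%N by lia.
have jt : (j - plen a < size t')%N by lia.
have jt' : (j - plen a < size t)%N by lia.
move: yE'; rewrite yE; case: (z) (w) => [[u r]|f] [[u' r']|f'] //= [].
  by move=> _ /(congr1 (fun s => nth e0 s (j - plen a))); rewrite !nth_cat jt jt'.
move=> /(congr1 (fun k => k (j - plen a)%N)) /=.
by rewrite !(set_nth_default e0).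
Qed.

Lemma long_extension p a b : a <> b ->
  (forall s, walk (prng p) s -> meets (pext p s) a b) ->
  forall n, exists s, walk (prng p) s /\ size s = n.
Proof.
move=> nab K; elim=> [|n [s [ws <-]]]; first by exists [::].
have [e ep] : exists e, esrc e = prng (pext p s).
  apply: contrapT => none; apply: nab; apply: (meets_sink (K s ws)).
  by apply/seteqP; split=> // e ee; apply: none; exists e.
exists (rcons s e); rewrite size_rcons -cats1 walk_cat ws /= -prng_pext ep.
by rewrite eqxx.
Qed.

Hypothesis cycle_exit : forall c : prepath E, is_cycle c -> has_exit c.

(** Otherwise every extension of [p] would be periodic from some point on, with
    a period that only depends on [a] and [b]; a cycle met beyond that point
    would be forced at each step and so have no exit. *)
Lemma separate_lt p a b : is_path p -> bipath a b -> (plen a < plen b)%N ->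
  exists s, walk (prng p) s /\ ~ meets (pext p s) a b.
Proof.
move=> pp [pa pb eab] ltab; apply: contrapT => nos.
have K s : walk (prng p) s -> meets (pext p s) a b.
  by move=> ws; apply: contrapT => ns; apply: nos; exists s.
have nab : a <> b by move=> eab'; rewrite eab' ltnn in ltab.
pose d := (plen b - plen a)%N; have d0 : (0 < d)%N by rewrite subn_gt0.
have [s [ws sz]] := long_extension nab K (plen b + d.+1)%N.
have [e0 _] : exists e : edge E, True.
  by case: s sz {ws} => [|e s _]; [rewrite addnS|exists e].
pose s0 := take (plen b) s; pose s1 := take d (drop (plen b) s).
pose e1 := nth e0 s (plen b + d).
have sE : s = s0 ++ s1 ++ [:: e1].
  rewrite -[LHS](cat_take_drop (plen b)); congr (_ ++ _).
  rewrite -[LHS](cat_take_drop d); congr (_ ++ _).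
  rewrite drop_drop (drop_nth e0); last by rewrite sz; lia.
  by rewrite addnC drop_oversize// sz; lia.
have sz0 : size s0 = plen b by rewrite size_takel// sz leq_addr.
have sz1 : size s1 = d by rewrite size_takel// size_drop sz; lia.
have nthq t i : nth e0 (pext p t).2 (plen p + i) = nth e0 t i.
  by rewrite /= nth_cat -/(plen p) ifN ?addKn// -leqNgt leq_addr.
have ws01 := ws; rewrite sE !walk_cat in ws01.
have /and3P[w0 w1 /andP[/eqP e1E _]] := ws01.
have pq t : walk (prng p) t -> is_path (pext p t) by rewrite is_path_pext pp.
have perE t i : walk (prng p) t -> (plen a <= i)%N -> (i + d < size t)%N ->
    nth e0 t i = nth e0 t (i + d).
  move=> wt ai idt; rewrite -[LHS]nthq -[RHS]nthq addnA.
  apply: meets_periodic => //; [exact: pq|exact: K|lia|].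
  rewrite plen_pext -/d; lia.
have [c [cyc cs]] : exists c, is_cycle c /\ {subset c.2 <= s1}.
  apply: (closed_walk_cycle w1); first by rewrite -size_eq0 sz1 -lt0n.
  rewrite -e1E.
  have -> : e1 = nth e0 s1 0.
    have := perE s (plen b) ws; rewrite -/e1 => <-; [|lia|rewrite sz; lia].
    by rewrite {1}sE nth_cat sz0 ltnn subnn nth_cat sz1 d0.
  by move: w1 d0; rewrite -sz1; case: (s1) => //= e r /andP[/eqP].
have [f [e [ec fe nfe]]] := cycle_exit cyc.
have [t1 [t2 s1E]] : exists t1 t2, s1 = t1 ++ e :: t2.
  by have := cs _ ec; case/path.splitPr => t1 t2; exists t1, t2.
have wt g : esrc g = esrc e -> walk (prng p) (s0 ++ t1 ++ [:: g]).
  move=> ge; move: w1; rewrite s1E !walk_cat w0 /= => /andP[-> /andP[/eqP <- _]].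
  by rewrite ge eqxx.
(* The edge at depth [plen b + size t1] repeats the one at depth
   [plen b + size t1 - d], which lies before the exit is taken. *)
have last_letter g : esrc g = esrc e ->
    g = nth e0 (s0 ++ t1) (plen b + size t1 - d).
  move=> ge.
  have -> : g = nth e0 (s0 ++ t1 ++ [:: g]) (plen b + size t1 - d + d).
    rewrite subnK; last by rewrite /d; lia.
    by rewrite catA nth_cat size_cat sz0 ltnn subnn.
  rewrite -perE; [|exact: wt|rewrite /d; lia|].
    rewrite catA nth_cat ifT// size_cat sz0; lia.
  rewrite !size_cat sz0 /=; lia.
by apply: nfe; rewrite (last_letter e erefl) (last_letter f fe).
Qed.

(** When [a] and [b] have the same length, a path extending both forces them to
    be equal; otherwise [separate_lt] applies to one of the two orders. *)
Lemma separate p a b : is_path p -> bipath a b -> a <> b ->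
  exists s, walk (prng p) s /\ ~ meets (pext p s) a b.
Proof.
move=> pp ab nab; have [pa pb eab] := ab.
have [lt|lt|elen] := ltngtP (plen a) (plen b); first exact: separate_lt.
  have [s [ws ns]] := separate_lt pp (bipath_sym ab) lt.
  by exists s; split=> // /(meets_sym eab).
apply: contrapT => nos.
have K s : walk (prng p) s -> meets (pext p s) a b.
  by move=> ws; apply: contrapT => ns; apply: nos; exists s.
have [s [ws sz]] := long_extension nab K (plen a).
have [y [z [w [[bY ya] [bz zq] [bw wq] az bw']]]] := K s ws.
have pq : is_path (pext p s) by rewrite is_path_pext pp.
have laq : (plen a <= plen (pext p s))%N by rewrite plen_pext sz leq_addl.
have lbq : (plen b <= plen (pext p s))%N by rewrite -elen.
have [t [qa _ _]] := pcat_split pa pq (esym ya) (esym zq) laq az.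
have yb : prng b = gpath_src y by rewrite -eab.
have [t' [qb _ _]] := pcat_split pb pq yb (esym wq) lbq bw'.
apply: nab; move: qa; rewrite qb => -[e /eqP]; rewrite eqseq_cat//.
by move=> /andP[/eqP e2 _]; rewrite [a]surjective_pairing [b]surjective_pairing e e2.
Qed.

End Aperiodicity.

(** * Compression to a vertex *)

Section Corners.
Variables (E : digraph) (S : comNzSemiRingType).
Local Notation G := (graph_groupoid E).
Local Notation A := (@steinberg G S).
Local Notation char := (@char_fun G S).
Local Notation conv := (@convolution G S).
Local Notation vchar := (@vchar E S).
Implicit Types (a b c p q : prepath E) (x y z w : gpath E).
Implicit Types (g h r : graph_arrow E) (f k u : graph_arrow E -> S).

Lemma convolution0r f : conv f 0 = 0.
Proof. by apply/funext => r; rewrite convolutionE fsbig1// => p _; rewrite mulr0. Qed.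

Lemma convolution0l f : conv 0 f = 0.
Proof. by apply/funext => r; rewrite convolutionE fsbig1// => p _; rewrite mul0r. Qed.

Lemma convolution_scalel (c : S) f k : A f ->
  conv (fun g => c * f g) k = fun r => c * conv f k r.
Proof.
move=> Af; apply/funext => r; rewrite !convolution_row fsum_distrr; last exact: row_finite.
transitivity (\sum_(g \in row (ga_rng r) f) c * f g * k (ldiv g r)).
  apply: fsbig_widen => [g [gr cf]|g /= [[gr _] ncf]].
    by split=> // fg; apply: cf; rewrite fg mulr0.
  have [->|/eqP cf] := eqVneq (c * f g) 0; first by rewrite mul0r.
  by case: ncf.
by apply: eq_fsbigr => g _; rewrite mulrA.
Qed.

Lemma unit_rng_Zset a r : Zset a a (ga_unit_rng r) <->
  exists y, [/\ is_boundary y, gpath_src y = prng a & ga_rng r = pcat a y].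
Proof.
split=> [[y [bY ya [rE _]]]|[y [bY ya rE]]]; exists y; split=> //.
by rewrite /= rE /lag_triple subrr.
Qed.

Lemma Zset_unit_rng a b r : Zset a b r -> Zset a a (ga_unit_rng r).
Proof.
by move=> [y [bY ya rE]]; apply/unit_rng_Zset; exists y; rewrite /ga_rng rE.
Qed.

Lemma convolution_char_id a f : is_path a ->
  (forall r, f r <> 0 -> Zset a a (ga_unit_rng r)) ->
  conv (char (Zset a a)) f = f.
Proof.
move=> pa fa; apply/funext => r.
have [/unit_rng_Zset[y [bY ya rE]]|nr] := pselect (Zset a a (ga_unit_rng r)).
  have [s [d [x [ws asd bx xs rE']]]] := arrow_lag_prefix pa bY ya rE.
  exact: (convolution_charl_lag f (bipathxx pa) ws bx xs rE' rE').
rewrite convolution_charl0; last first.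
  by move=> y bY ya rE; apply: nr; apply/unit_rng_Zset; exists y.
by have [->|/eqP/fa] := eqVneq (f r) 0.
Qed.

Lemma convolution_char_char a b c : bipath a b -> bipath b c ->
  conv (char (Zset a b)) (char (Zset b c)) = char (Zset a c).
Proof.
move=> ab bc; have [pa pb eab] := ab; have [_ pc ebc] := bc.
apply/funext => r; have [[y [bY ya rE]]|nr] := pselect (exists y,
    [/\ is_boundary y, gpath_src y = prng a & ga_rng r = pcat a y]); last first.
  rewrite convolution_charl0; last by move=> y bY ya rE; apply: nr; exists y.
  rewrite char_funE; case: ifP => // /set_mem[y [bY ya rE]].
  by case: nr; exists y; rewrite /ga_rng rE.
have [g gE] := arrow_exists ab bY ya.
have gZ : Zset a b g by exists y.
have gr : ga_rng g = ga_rng r by rewrite rE /ga_rng gE.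
have [h ghr] := composes_divl gr.
rewrite (convolution_charl _ ab gZ ghr) !char_funE.
congr (if _ then _ else _); apply/idP/idP => /set_mem[y' [bY' ya' hE]]; apply: mem_set.
  exists y'; split=> //; first by rewrite ya'.
  have [egh ->] := ghr; have byy : pcat b y = pcat b y'.
    by move: egh; rewrite /ga_src /ga_rng /= gE hE.
  have {byy} yE : y = y' by apply: (pcat_inj pb _ _ byy) => //; rewrite -eab.
  rewrite /ga_rng /ga_lag /ga_src /= gE hE /= yE /lag_triple.
  by congr (_, _, _); lia.
have yE : y = y'.
  by apply: (pcat_inj pa) => //; rewrite -rE /ga_rng hE.
have yb : gpath_src y = prng b by rewrite -eab.
have [h' h'E] := arrow_exists bc bY yb.
rewrite -yE in hE.
rewrite (composes_injl ghr (composes_lag_triple gE h'E hE)).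
by exists y.
Qed.

(** Compression of [f] to the vertex at the end of [a] and [b]: the value at
    [(x, k, y)] becomes the value of [f] at [(a x, k + |a| - |b|, b y)]. *)
Definition compress a b f : graph_arrow E -> S :=
  conv (conv (char (Zset (vpath (prng a)) a)) f)
       (char (Zset b (vpath (prng a)))).

Lemma compress_steinberg a b f : bipath a b -> A f -> A (compress a b f).
Proof.
move=> [pa pb ab] Af; apply: convolution_charr_steinberg => //.
exact: convolution_charl_steinberg.
Qed.

Lemma composes_divr h r : ga_src h = ga_src r -> exists g, composes (g, h) r.
Proof.
move=> hr; have [|g gP] := @composes_divl _ (ga_inv h) (ga_inv r); first exact: hr.
exists (ga_inv g); have := composes_inv gP.
by rewrite /= !ga_invK.
Qed.

Lemma compressE a b f r z w : bipath a b -> is_boundary z -> is_boundary w ->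
  gpath_src z = prng a -> gpath_src w = prng a -> ga_rng r = z ->
  ga_src r = w -> exists h, [/\ ga_rng h = pcat a z, ga_src h = pcat b w,
    ga_lag h = ga_lag r + (plen a)%:Z - (plen b)%:Z & compress a b f r = f h].
Proof.
move=> [pa pb ab] bz bw za wa rz rw; set v := vpath (prng a).
have va : bipath v a by [].
have bv : bipath b v by [].
have wb : gpath_src w = prng b by rewrite -ab.
have [h2 h2E] := arrow_exists bv bw wb.
have [g1 g1E] := arrow_exists va bz za.
have vcat x : gpath_src x = prng a -> pcat v x = x by move=> xa; rewrite /v -xa; exact: pcat_nil.
have h2r : ga_src h2 = ga_src r by rewrite rw /ga_src h2E /= vcat.
have [g gh2] := composes_divr h2r.
have g1g : ga_rng g1 = ga_rng g.
  by rewrite -(composes_rng gh2) rz /ga_rng g1E /= vcat.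
have [h g1h] := composes_divl g1g.
exists h; rewrite /compress (convolution_charr _ bv _ gh2); last by exists w.
rewrite (convolution_charl _ va _ g1h); last by exists z.
split=> //.
- by have [/= <- _] := g1h; rewrite /ga_src g1E.
- by rewrite -(composes_src g1h); have [/= -> _] := gh2; rewrite /ga_rng h2E.
have := composes_lag gh2; have := composes_lag g1h => /=.
rewrite /ga_lag g1E h2E /= -[plen v]/0%N => -> ->; lia.
Qed.

Lemma compress_neq0 a b f r : bipath a b -> compress a b f r <> 0 ->
  [/\ is_boundary (ga_rng r) /\ gpath_src (ga_rng r) = prng a &
      is_boundary (ga_src r) /\ gpath_src (ga_src r) = prng a].
Proof.
move=> [pa pb ab] /convolution_neq0[[g h] [gh + /char_neq0]] /=.
move=> /convolution_neq0[[g1 h1] [gh1 /char_neq0]] /=.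
move=> [z [bz za zE]] _ [w [bw wb hE]].
rewrite (composes_rng gh) (composes_rng gh1) (composes_src gh).
rewrite /ga_rng /ga_src zE hE /=.
have wa : gpath_src w = prng a by rewrite wb ab.
have vcat x : gpath_src x = prng a -> pcat (vpath (prng a)) x = x.
  by move=> xa; rewrite -xa; exact: pcat_nil.
by rewrite !vcat.
Qed.

Hypothesis cycle_exit : forall c : prepath E, is_cycle c -> has_exit c.

(** The cylinders of a covering are separated one after another; a separation
    persists when the path is extended. *)
Lemma separate_covered (L : seq (prepath E * prepath E)) p : is_path p ->
  exists s, walk (prng p) s /\ forall g, covered L g ->
    exists a b, [/\ bipath a b, Zset a b g & a <> b -> ~ meets (pext p s) a b].
Proof.
move=> pp; elim: L => [|[a b] L [s [ws IHs]]]; first by exists [::].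
have ps : is_path (pext p s) by rewrite is_path_pext pp.
have [t [wt tP]] : exists t, walk (prng (pext p s)) t /\
    (bipath a b -> a <> b -> ~ meets (pext (pext p s) t) a b).
  have [[ab nab]|no] := pselect (bipath a b /\ a <> b); last first.
    by exists [::]; split=> // ab nab; case: no.
  by have [t [wt nt]] := separate cycle_exit ps ab nab; exists t.
exists (s ++ t); rewrite walk_cat ws -prng_pext wt; split=> // g.
rewrite pext_cat => -[[ab gZ]|/IHs[a' [b' [ab gZ nm]]]].
  by exists a, b; split=> //; exact: tP.
by exists a', b'; split=> // /nm nm' /(meets_pext ps wt).
Qed.

(** Near the unit [g0] both functions are constant, and separating the cylinders
    of their supports removes the arrows that are not units; on the
    cylinder of a suitable [p], only the value at [g0] remains.  The path [p]
    may leave [x], which is harmless since the diagonal part is already constant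
    near [x]. *)
Lemma diagonalize v x g0 f k : A f -> A k -> is_boundary x ->
  gpath_src x = v -> arrow_val g0 = lag_triple (vpath v) (vpath v) x ->
  exists p, is_path p /\ forall u, u = f \/ u = k ->
    compress p p u = fun r => u g0 * vchar (prng p) r.
Proof.
move=> Af Ak bx xv g0E.
have [cf [Lf fL]] := steinberg_locally_constant Af.
have [ck [Lk kL]] := steinberg_locally_constant Ak.
have vv : bipath (vpath v) (vpath v) by [].
have fk : nbhs g0 [set g | f g = f g0 /\ k g = k g0].
  exact: filterI (cf g0) (ck g0).
have := nbhs_arrow vv bx xv g0E fk.
move=> [s [y [F [ws xE bY ys [finF Fs yF sN]]]]].
set p0 := pext (vpath v) s in ys Fs sN.
have pp0 : is_path p0 by rewrite is_path_pext.
(* A basic set contains a full cylinder: either some edge is not removed, or no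
   edge is removed at all. *)
have [t [wt tN]] : exists t, walk (prng p0) t /\
    Zset (pext p0 t) (pext p0 t) `<=` ZsetF p0 p0 F.
  have [[e [ep nFe]]|none] := pselect (exists e, esrc e = prng p0 /\ ~ F e).
    have we : walk (prng p0) [:: e] by rewrite /= ep eqxx.
    exists [:: e]; split=> // g [z [bz zp gE]].
    have pe : is_path (prng p0, [:: e]) by [].
    have re : prng (prng p0, [:: e]) = gpath_src z by rewrite zp prng_pext.
    rewrite (lag_triple_pext _ _ (prng p0)) in gE.
    apply/(ZsetFE (bipathxx pp0) Fs _ _ gE); last by rewrite starts_in_cons.
      exact: pcat_boundary.
    by rewrite gpath_src_pcat.
  have outF : out_edges (prng p0) `<=` F.
    by move=> e ep; apply: contrapT => nFe; apply: none; exists e.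
  have F0 : F = set0.
    apply/seteqP; split=> // e Fe.
    case: y bY ys yF {xE} => [[u [|e' r]] [wu bd]|h bh] yu yF.
    - have up : u = prng p0 by [].
      case: bd => [sink|inf]; first by rewrite -sink -[prng _]/u up; exact: Fs.
      by case: inf; rewrite -[prng _]/u up; apply: sub_finite_set outF finF.
    - case: yF; apply: outF; case/andP: wu => /eqP e'u _.
      by rewrite /out_edges /= e'u.
    - by case: yF; apply: outF.
  by exists [::]; rewrite !pext_nil F0 Zset_ZsetF0; split.
set p1 := pext p0 t; have pp1 : is_path p1 by rewrite is_path_pext pp0.
have [s' [ws' sep]] := separate_covered (Lf ++ Lk) pp1.
set p := pext p1 s'; have pp : is_path p by rewrite is_path_pext pp1.
exists p; split=> // u ufk; apply/funext => r.
have uL g : u g <> 0 -> covered (Lf ++ Lk) g.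
  by move=> ug; apply/covered_cat; case: ufk ug => -> => [/fL|/kL]; [left|right].
have uN g : Zset p p g -> u g = u g0.
  move=> gp; have [fg kg] : [set g | f g = f g0 /\ k g = k g0] g.
    by apply: sN; apply: tN; apply: Zset_pext_sub gp.
  by case: ufk => ->.
have ppp : bipath p p by [].
have [[[bz zp] [bw wp]]|nr] := pselect
    ((is_boundary (ga_rng r) /\ gpath_src (ga_rng r) = prng p) /\
     (is_boundary (ga_src r) /\ gpath_src (ga_src r) = prng p)); last first.
  have -> : compress p p u r = 0.
    by apply: contrapT => /(compress_neq0 ppp)[? ?]; apply: nr.
  rewrite /vchar char_funE; case: ifP => [/set_mem[z [bz zp rE]]|_]; last by rewrite mulr0.
  have vz : pcat (vpath (prng p)) z = z.
    by have <- : gpath_src z = prng p := zp; exact: pcat_nil.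
  by case: nr; rewrite /ga_rng /ga_src rE /= vz.
have [h [hz hw hl ->]] := compressE u ppp bz bw zp wp erefl erefl.
rewrite addrK in hl.
have vcat z : gpath_src z = prng p -> pcat (vpath (prng p)) z = z.
  by move=> zE; rewrite -zE; exact: pcat_nil.
rewrite /vchar char_funE; case: ifP => [/set_mem[z [bz' zp' rE]]|/negP nrp].
  rewrite mulr1; apply: uN; exists z; split=> //.
  move: hz hw hl; rewrite /ga_rng /ga_src /ga_lag rE /= !vcat// subrr.
  case: (arrow_val h) => [[h1 h2] h3] /= -> -> ->.
  by rewrite /lag_triple subrr.
rewrite mulr0; apply: contrapT => uh.
have [a [b [ab [y' [bY' y'a hE]] sepab]]] := sep _ (uL _ uh).
have [pa pb eab] := ab.
have az : pcat a y' = pcat p (ga_rng r) by rewrite -hz /ga_rng hE.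
have bz' : pcat b y' = pcat p (ga_src r) by rewrite -hw /ga_src hE.
have [abE|nab] := pselect (a = b); last first.
  by apply: (sepab nab); exists y', (ga_rng r), (ga_src r).
apply: nrp; apply: mem_set; exists (ga_rng r); split=> //.
subst b; have rr : ga_rng r = ga_src r.
  by apply: (pcat_inj pp); rewrite -?az -?bz'.
have l0 : ga_lag r = 0 by rewrite -hl /ga_lag hE /= subrr.
rewrite /lag_triple subrr vcat// {2}rr -l0.
by rewrite /ga_rng /ga_lag /ga_src; case: (arrow_val r) => [[]].
Qed.

End Corners.

(** * Sufficiency of the three conditions *)

Section Sufficiency.
Variables (E : digraph) (S : comNzSemiRingType).
Local Notation G := (graph_groupoid E).
Local Notation A := (@steinberg G S).
Local Notation char := (@char_fun G S).
Local Notation conv := (@convolution G S).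
Local Notation vchar := (@vchar E S).
Implicit Types (a b c p q : prepath E) (x y z w : gpath E).
Implicit Types (g h r : graph_arrow E) (f k u : graph_arrow E -> S).

Variable rho : (graph_arrow E -> S) -> (graph_arrow E -> S) -> Prop.
Hypothesis rho_cong : congruence conv A rho.

Let A0 : A 0. Proof. by case: (subsemimodule_steinberg E S). Qed.
Let AD f k : A f -> A k -> A (f + k).
Proof. by case: (subsemimodule_steinberg E S) => _ + _; apply. Qed.
Let AZ (c : S) f : A f -> A (fun g => c * f g).
Proof. by case: (subsemimodule_steinberg E S) => _ _; apply. Qed.
Let AZset a b : bipath a b -> A (char (Zset a b)).
Proof. exact: char_Zset_steinberg. Qed.

Let rho_mull f k u : A f -> A k -> A u -> rho f k -> rho (conv u f) (conv u k).
Proof. by case: rho_cong => _ _ _ H Af Ak Au /(H _ _ u Af Ak Au)[]. Qed.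
Let rho_mulr f k u : A f -> A k -> A u -> rho f k -> rho (conv f u) (conv k u).
Proof. by case: rho_cong => _ _ _ H Af Ak Au /(H _ _ u Af Ak Au)[]. Qed.

Lemma rho0_mull f u : A f -> A u -> rho f 0 -> rho (conv u f) 0.
Proof.
by move=> Af Au f0; have := rho_mull Af A0 Au f0; rewrite convolution0r.
Qed.

Lemma rho0_mulr f u : A f -> A u -> rho f 0 -> rho (conv f u) 0.
Proof.
by move=> Af Au f0; have := rho_mulr Af A0 Au f0; rewrite convolution0l.
Qed.

Lemma rho0_add f k : A f -> A k -> rho f 0 -> rho k 0 -> rho (f + k) 0.
Proof.
move=> Af Ak f0 k0; have [_ _ tr H] := rho_cong.
have [fk _ _] := H _ _ _ Ak A0 Af k0; rewrite addr0 in fk.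
exact: tr (AD Af Ak) Af A0 fk f0.
Qed.

(** Two functions that differ at an arrow are first translated so that they
    differ at a unit, and then compressed to a vertex by [diagonalize]. *)
Lemma nontrivial_vertex (cycle_exit : forall c, is_cycle c -> has_exit c) f k :
  A f -> A k -> rho f k -> f <> k -> exists v (c d : S), c <> d /\
    rho (fun g => c * vchar v g) (fun g => d * vchar v g).
Proof.
move=> Af Ak fk nfk; have [g0 nfkg] : exists g, f g <> k g.
  by apply: contrapT => /forallNP eqfk; apply: nfk; apply/funext => g;
    apply: contrapT; exact: eqfk.
have rho_compress a b u u' : bipath a b -> A u -> A u' -> rho u u' ->
    rho (compress a b u) (compress a b u').
  move=> [pa pb ab] Au Au' uu'.
  have va : bipath (vpath (prng a)) a by [].
  have bv : bipath b (vpath (prng a)) by [].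
  apply: rho_mulr; [exact: convolution_charl_steinberg..|exact: AZset|].
  by apply: rho_mull => //; exact: AZset.
have [a [b [x [ab bx xa gE]]]] := arrow_lagP g0.
have vv : bipath (vpath (prng a)) (vpath (prng a)) by [].
have [g1 [g1E g1x]] := unit_arrow bx xa.
have vx : pcat (vpath (prng a)) x = x by rewrite -xa; exact: pcat_nil.
have g1s : ga_src g1 = x by rewrite /ga_src g1E /=.
have at_g1 u : compress a b u g1 = u g0.
  have [h [hr hs hl ->]] := compressE u ab bx bx xa xa g1x g1s.
  congr u; apply: arrow_eq; rewrite ?hr ?hs ?hl.
  - by rewrite /ga_rng gE.
  - by rewrite /ga_lag g1E gE /=; lia.
  - by rewrite /ga_src gE.
have Af1 := compress_steinberg ab Af; have Ak1 := compress_steinberg ab Ak.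
have [p [pp diag]] := diagonalize cycle_exit Af1 Ak1 bx xa g1E.
exists (prng p), (f g0), (k g0); split=> //.
rewrite -!at_g1 -!diag; [|by right|by left].
have fk1 := rho_compress a b f k ab Af Ak fk.
exact: rho_compress (bipathxx pp) Af1 Ak1 fk1.
Qed.

(** Over a field, subtracting [d] and dividing by [c - d] turns the pair into
    the desired one.  Over the Boolean semifield, it already is that pair, up
    to symmetry. *)
Lemma vertex_killed v (c d : S) : is_field S \/ is_boolean_semifield S ->
  c <> d -> rho (fun g => c * vchar v g) (fun g => d * vchar v g) ->
  rho (vchar v) 0.
Proof.
have Av : A (vchar v) by exact: vchar_steinberg.
have v1 : (fun g => 1 * vchar v g) = vchar v by apply/funext => g; rewrite mul1r.
have v0 : (fun g => 0 * vchar v g) = 0 by apply/funext => g; rewrite mul0r.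
have [_ sym _ H] := rho_cong.
case=> [[opp inv]|[phi [bij [phi0 phi1 _ _]]]] cd rcd.
  have [n dn] := opp d.
  have [i ci] : exists i, (n + c) * i = 1.
    apply: inv => nc; apply: cd; rewrite -[c]addr0 -dn addrCA [c + n]addrC nc.
    by rewrite addr0.
  have [+ _ _] := H _ _ _ (AZ c Av) (AZ d Av) (AZ n Av) rcd.
  have vD (e : S) : (fun g => n * vchar v g) + (fun g => e * vchar v g) =
      fun g => (n + e) * vchar v g.
    by apply/funext => g; rewrite addrfctE mulrDl.
  rewrite !vD [n + d]addrC dn v0 => r0.
  have := rho0_mull (AZ (n + c) Av) (AZ i Av) r0.
  rewrite convolution_scalel// convolution_char_id//; last first.
    move=> r nz; have /char_neq0/Zset_unit_rng// : vchar v r <> 0.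
    by move=> r0'; apply: nz; rewrite r0' mulr0.
  have -> // : (fun r => i * ((n + c) * vchar v r)) = vchar v.
  by apply/funext => r; rewrite mulrA [i * _]mulrC ci mul1r.
have two (e : S) : e = 0 \/ e = 1.
  have := bij_inj bij; case E1 : (phi e) => inj; [right|left]; apply: inj.
    by rewrite E1 phi1.
  by rewrite E1 phi0.
have [ce|ce] := two c; have [de|de] := two d; move: cd rcd; rewrite ce de ?v1 ?v0 //.
by move=> _ /(sym _ _ A0 Av).
Qed.

(** The part of [f] with ranges in the cylinder of [a] is a product whose left
    factor is the idempotent of [a]; splitting off these clopen parts one after
    another exhausts [f]. *)
Lemma killed_by_ranges (L : seq (vertex E * seq (edge E))) f : A f ->
  (forall r, f r <> 0 -> exists a : prepath E, [/\ a \in L, is_path a,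
    rho (char (Zset a a)) 0 & Zset a a (ga_unit_rng r)]) -> rho f 0.
Proof.
elim: L f => [|a L IHL] f Af fL.
  have -> : f = 0; last by case: rho_cong => + _ _ _; apply.
  by apply/funext => g; apply/eqP/contraT => /eqP/fL[a []].
have [[pa a0]|na] := pselect (is_path (a : prepath E) /\
    rho (char (Zset (a : prepath E) a)) 0); last first.
  apply: IHL => // r /fL[b [+ pb b0 rb]]; rewrite inE => /predU1P[ba|bL].
    by case: na; rewrite -ba.
  by exists b.
have aa := bipathxx pa; pose U := @ga_unit_rng E @^-1` Zset a a.
have oU : open U.
  by apply: open_comp => [g _|]; [exact: ga_unit_rng_continuous|exact: Zset_open].
have cU : closed U.
  apply: preimage_closed; [|exact: Zset_closed].
  by move=> g _; exact: ga_unit_rng_continuous.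
have [cf [M fM]] := steinberg_locally_constant Af.
have Ares V : open V -> closed V -> A (restrict_fun f V).
  move=> oV cV; apply: locally_constant_steinberg.
    exact: restrict_locally_constant.
  by exists M => g; rewrite /restrict_fun; case: ifP => // _ /fM.
rewrite (restrict_split f U); apply: rho0_add.
- exact: Ares.
- by apply: Ares; [exact: closed_openC|exact: open_closedC].
- rewrite -(@convolution_char_id _ _ a (restrict_fun f U))//.
    by apply: rho0_mulr => //; [exact: AZset|exact: Ares].
  by move=> r; rewrite /restrict_fun; case: ifP => // /set_mem.
apply: IHL; first by apply: Ares; [exact: closed_openC|exact: open_closedC].
move=> r; rewrite /restrict_fun; case: ifP => // /set_mem nrU /fL[b [+ pb b0 rb]].
by rewrite inE => /predU1P[ba|bL]; [case: nrU; rewrite /U /= -ba|exists b].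
Qed.

Lemma vchar_killed_path a : is_path a -> rho (vchar (prng a)) 0 ->
  rho (char (Zset a a)) 0.
Proof.
move=> pa a0; have va : bipath (vpath (prng a)) a by [].
have av := bipath_sym va; have vv := bipathxx (isT : is_path (vpath (prng a))).
rewrite -(convolution_char_char S av va).
apply: rho0_mulr; [exact: AZset..|].
rewrite -(convolution_char_char S av vv).
by apply: rho0_mull => //; exact: AZset.
Qed.

(** The idempotent of the end of an edge is a multiple of the one of its source. *)
Lemma killed_hereditary : hereditary [set v | rho (vchar v) 0].
Proof.
move=> e /= v0; pose a : prepath E := (esrc e, [:: e]).
have pa : is_path a by rewrite /is_path /= eqxx.
have va : bipath (vpath (prng a)) a by [].
have av := bipath_sym va.
rewrite /vchar -[etgt e]/(prng a) -(convolution_char_char S va av).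
apply: rho0_mull; [exact: AZset..|].
rewrite -(@convolution_char_id _ _ (vpath (esrc e)) (char (Zset a _)))//.
  by apply: rho0_mulr => //; exact: AZset.
move=> r /char_neq0[y [bY ya rE]]; apply/unit_rng_Zset.
exists (pcat a y); split.
- by apply: pcat_boundary.
- by rewrite gpath_src_pcat.
have -> : vpath (esrc e) = (gpath_src (pcat a y), [::]) by rewrite gpath_src_pcat.
by rewrite pcat_nil /ga_rng rE.
Qed.

(** The cylinder of a regular vertex is the union of the cylinders of the
    finitely many edges that it emits. *)
Lemma killed_saturated : saturated [set v | rho (vchar v) 0].
Proof.
move=> v [[e0 e0v] fin] out0; have /finite_seqP[es esE] := fin.
apply: (killed_by_ranges (@vchar_steinberg E S v)
  (L := [seq (v, [:: e]) | e <- es])).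
move=> r /char_neq0[y [bY yv rE]].
have ry : ga_rng r = y.
  by rewrite /ga_rng rE /=; have <- : gpath_src y = v := yv; exact: pcat_nil.
have out : starts_in (out_edges v) y.
  case: y bY yv {rE ry} => [[w [|e s]] [wt bd]|//] wv.
    have wv' : w = v by [].
    case: bd; rewrite -[prng _]/w wv'; last by move=> /(_ fin).
    by rewrite /is_sink => v0; move: e0v; rewrite v0.
  by case/andP: wt => /eqP ev _; rewrite /= /out_edges /= ev.
have [e [y' [oe bY' y'e _ yE]]] := starts_inP bY out.
have pe : is_path (v, [:: e]) by rewrite /is_path /= oe eqxx.
exists (v, [:: e]); split=> //.
- by apply/mapP; exists e => //; move: oe; rewrite esE.
- by apply: vchar_killed_path => //; apply: out0; exists e.
apply/unit_rng_Zset; exists y'; split=> //.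
by rewrite ry yE; congr (pcat (_, _) _).
Qed.

Lemma killed_all : (forall v, rho (vchar v) 0) -> forall f k, A f -> A k -> rho f k.
Proof.
move=> all0; have zero f : A f -> rho f 0.
  move=> Af; have [_ [L fL]] := steinberg_locally_constant Af.
  apply: (@killed_by_ranges [seq ab.1 | ab <- L]) => // r /fL.
  elim: L {fL} => //= -[a b] L IHL [[[pa pb ab] [y [bY ya rE]]]|/IHL].
    exists a; split=> //; first by rewrite inE eqxx.
      exact: vchar_killed_path.
    by apply: Zset_unit_rng; exists y; split; last exact: rE.
  by move=> [c [cL ? ? ?]]; exists c; split; rewrite // inE cL orbT.
move=> f k Af Ak; have [_ sym tr _] := rho_cong.
apply: (tr f 0 k) => //; first exact: zero.
by apply: sym => //; exact: zero.
Qed.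

End Sufficiency.

(** * The characterization *)

Unset Implicit Arguments.

Theorem theorem4p3 (E : digraph) (E_nonempty : inhabited (vertex E))
    (S : comNzSemiRingType) :
  congruence_simple (@convolution (graph_groupoid E) S)
    (@steinberg (graph_groupoid E) S) <->
  [/\ is_field S \/ is_boolean_semifield S,
      forall H : set (vertex E), hereditary H -> saturated H ->
        H = set0 \/ H = setT
    & forall c : prepath E, is_cycle c -> has_exit c].
Proof.
have [v0] := E_nonempty.
split=> [simple|[fieldS minimal exits]].
  split; [|exact: hereditary_saturated_trivial simple|exact: cycle_has_exit simple].
  exact/simple_field_or_boolean/(coefficients_simple v0 simple).
split.
  have [x [bx xv]] := boundary_exists v0; have [g [gE _]] := unit_arrow bx xv.
  exists (@vchar E S v0); first exact: vchar_steinberg.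
  move=> /(congr1 (fun f => f g)); rewrite (vchar1 S bx xv gE) => /eqP.
  by rewrite oner_eq0.
move=> rho rho_cong.
have [triv|ntriv] := pselect (forall f k, steinberg f -> steinberg k ->
  rho f k -> f = k); first by left.
right.
have [f [k [Af Ak fk nfk]]] : exists f k,
    [/\ steinberg f, steinberg k, rho f k & f <> k].
  apply: contrapT => none; apply: ntriv => f k Af Ak fk.
  by apply: contrapT => nfk; apply: none; exists f, k.
have [v [c [d [cd rcd]]]] := nontrivial_vertex rho_cong exits Af Ak fk nfk.
have v_killed := vertex_killed rho_cong fieldS cd rcd.
apply: (killed_all rho_cong).
have [H0|HT] := minimal _ (killed_hereditary rho_cong) (killed_saturated rho_cong).
  by have : [set u | rho (vchar S u) 0] v := v_killed; rewrite H0.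
by move=> u; have : [set: vertex E] u by []; rewrite -HT.
Qed.
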